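(* Assume that $\mu$ is critical and $\mu\in\mathrm{dom}(2)$ (i.e. $\alpha=2$: $\mu$ is attracted to a Gaussian distribution), and that $\theta$, defined on $\mathbb Z^4$, has a finite moment of order $\delta$ for some $\delta>4$. Then a $\mathcal T_n$-walk in $\mathbb Z^4$ with $\theta$-jumps is recurrent: $$\frac{R^\theta(\mathcal T_n)}{n}\longrightarrow0\quad\text{in probability as }n\to+\infty.$$
   Context: $\mu$ is a probability distribution on $\mathbb N=\{0,1,2,\dots\}$; critical means $\sum_k k\mu(k)=1$ and $\mu\neq\delta_1$; $\mu\in\mathrm{dom}(2)$ means that $\mathrm{Gen}_\mu(s)=\sum_k\mu(k)s^k$ satisfies $\mathrm{Gen}_\mu(1-s)-(1-s)=s^2L(1/s)$ for $s\in(0,1]$ with $L$ slowly varying at $+\infty$ (the variance of $\mu$ may be infinite). $\theta$ is a centered probability distribution on $\mathbb Z^4$ with invertible covariance matrix. $\mathcal T$ is a $\mu$-Bienaymé (Galton–Watson) tree, and $\mathcal T_n$ is $\mathcal T$ conditioned to have $n+1$ vertices ($n$ ranges over the integers for which this event has positive probability). A $\mathcal T_n$-walk with $\theta$-jumps is $(W(u))_{u\in\mathcal T_n}$ with $W(\text{root})=0$ and, given the tree, i.i.d. increments $W(u)-W(v)$ with law $\theta$ over the edges from parent $v$ to child $u$. Its range is $R^\theta(\mathcal T_n)=\#\{W(u):u\in\mathcal T_n\}$. *)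

(* Defs.v *)
From HB Require Import structures.
From mathcomp Require Import all_boot all_order all_algebra.
From mathcomp Require Import all_classical all_reals all_analysis.

Set Implicit Arguments.
Unset Strict Implicit.
Unset Printing Implicit Defensive.

Import Order.TTheory GRing.Theory Num.Theory.
Import numFieldNormedType.Exports.

Local Open Scope classical_set_scope.
Local Open Scope ring_scope.

(* Z^4, with the discrete sigma-algebra. *)
Definition Z4 : Type := 'rV[int]_4.

HB.instance Definition _ := GRing.Zmodule.on Z4.
HB.instance Definition _ := isPointed.Build Z4 0.
HB.instance Definition _ := @isMeasurable.Build default_measure_display
  Z4 (@discrete_measurable Z4) (@discrete_measurable0 Z4)
  (@discrete_measurableC Z4) (@discrete_measurableU Z4).

Definition z4coord (R : realType) (i : 'I_4) (x : Z4) : R := (x ord0 i)%:~R.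

Definition enorm (R : realType) (x : Z4) : R :=
  Num.sqrt (\sum_(i < 4) z4coord R i x ^+ 2).

(* Finiteness of the means is part of the definition: the integral of a
   function whose positive and negative parts are not both integrable is
   infinite here. *)
Definition centered (R : realType) (theta : probability Z4 R) : Prop :=
  forall i : 'I_4, ('E_theta[z4coord R i] = 0)%E.

Definition cov_matrix (R : realType) (theta : probability Z4 R) : 'M[R]_4 :=
  \matrix_(i, j) fine (covariance theta (z4coord R i) (z4coord R j)).

Definition finite_moment (R : realType) (theta : probability Z4 R) (p : R) :
    Prop :=
  ('E_theta[fun x => (enorm R x `^ p)%R] < +oo)%E.

Definition critical (R : realType) (mu : probability nat R) : Prop :=
  ('E_mu[fun k : nat => k%:R] = 1)%E /\ (mu : set nat -> \bar R) <> \d_1%N.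

Definition Gen (R : realType) (mu : probability nat R) (s : R) : R :=
  fine (\sum_(0 <= k <oo) mu [set k] * (s ^+ k)%:E)%E.

Definition slowly_varying (R : realType) (L : R -> R) : Prop :=
  [/\ measurable_fun (`]0, +oo[%classic : set R) L,
      forall x, 0 < x -> 0 < L x
    & forall c, 0 < c -> L (c * x) / L x @[x --> +oo] --> (1 : R)].

Definition dom2 (R : realType) (mu : probability nat R) : Prop :=
  exists2 L : R -> R, slowly_varying L &
    forall s, 0 < s <= 1 ->
      Gen mu (1 - s) - (1 - s) = s ^+ 2 * L s^-1.

(* Finite rooted ordered (plane) trees: [Node [:: t_0; ...; t_(k-1)]] is the
   tree whose root has k children, from which t_0, ..., t_(k-1) descend. *)
Inductive tree : Type := Node of seq tree.

Definition subtrees (t : tree) : seq tree := let: Node s := t in s.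

Fixpoint tree_encode (t : tree) : GenTree.tree void :=
  let: Node s := t in GenTree.Node 0 (map tree_encode s).

Fixpoint tree_decode (g : GenTree.tree void) : tree :=
  match g with
  | GenTree.Leaf _ => Node [::]
  | GenTree.Node _ s => Node (map tree_decode s)
  end.

Lemma tree_encodeK : cancel tree_encode tree_decode.
Proof.
rewrite /cancel; fix IH 1; case=> s /=; congr Node.
elim: s => [//|t s IHs] /=; by rewrite IH IHs.
Qed.

HB.instance Definition _ := Countable.copy tree (can_type tree_encodeK).

(* The vertices, as Ulam words: the root is the empty word and the i-th child
   of u is [rcons u i] (children being numbered from 0). *)
Fixpoint vertices (t : tree) : seq (seq nat) :=
  let: Node s := t in
  [::] :: flatten [seq map (cons p.1) p.2
                  | p <- zip (iota 0 (size s)) (map vertices s)].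

Definition parent (u : seq nat) : seq nat := take (size u).-1 u.

(* The probability that the Bienayme tree with offspring law mu equals the
   finite tree t: its root has k children with probability mu {k}, and given
   this the k subtrees are independent Bienayme trees.  The mass possibly put
   on infinite trees is irrelevant below, where the number of vertices is
   fixed. *)
Fixpoint bienayme_law (R : realType) (mu : probability nat R) (t : tree) : R :=
  let: Node s := t in
  fine (mu [set size s]) * \prod_(p <- map (bienayme_law mu) s) p.

(* The probability that the Bienayme tree has m vertices. *)
Definition bienayme_size_law (R : realType) (mu : probability nat R)
    (m : nat) : R :=
  fine (\esum_(t in [set t | size (vertices t) = m]) (bienayme_law mu t)%:E).

(* The law of the Bienayme tree conditioned to have m vertices. *)
Definition conditioned_law (R : realType) (mu : probability nat R)
    (m : nat) (t : tree) : R :=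
  if size (vertices t) == m then bienayme_law mu t / bienayme_size_law mu m
  else 0.

(* T is distributed as the Bienayme tree conditioned to have n + 1 vertices,
   W is 0 at the root and, given T, the increments of W along the edges of T
   are independent with law theta.  The family W is indexed by all words, but
   only its values at the vertices of T matter. *)
Definition is_walk (R : realType) (mu : probability nat R)
    (theta : probability Z4 R) (n : nat)
    (d : measure_display) (Omega : measurableType d) (P : probability Omega R)
    (T : Omega -> tree) (W : Omega -> seq nat -> Z4) : Prop :=
  (forall w, W w [::] = 0) /\
  forall (t : tree) (x : seq nat -> Z4),
    let E := [set w | T w = t /\ forall u, u \in vertices t -> u != [::] ->
                        W w u - W w (parent u) = x u] in
    measurable E /\
    P E = (conditioned_law mu n.+1 t *
           \prod_(u <- vertices t | u != [::]) fine (theta [set x u]))%:E.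

Definition range_size (t : tree) (W : seq nat -> Z4) : nat :=
  size (undup (map W (vertices t))).

(* Main.v *)
Require Import Defs.
From HB Require Import structures.
From mathcomp Require Import all_boot all_order all_algebra.
From mathcomp Require Import finmap.
From mathcomp Require Import all_classical all_reals all_analysis.
From mathcomp Require Import ring lra zify.

Set Implicit Arguments.
Unset Strict Implicit.
Unset Printing Implicit Defensive.

Import Order.TTheory GRing.Theory Num.Theory.
Import numFieldNormedType.Exports.

Local Open Scope classical_set_scope.
Local Open Scope ring_scope.

(** The range is sublinear because an l2 bound on hitting probabilities is
  incompatible, in dimension four, with a range of linear size.

  Call a vertex wasted if its position is visited again later in depth-first
  order: the size minus the range is the number of wasted vertices ([waste]).
  A vertex that is wasted inside a piece of the tree is wasted in the whole
  tree.  Hence, charging each wasted vertex to its ancestors at distance less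
  than h, h times the waste of T is at least the sum over the vertices v of the
  waste of the tree hanging from v, cut at height h ([sum_waste_fringe]).  It
  remains to see that the trees hanging from the vertices of the conditioned
  tree look like unconditioned trees, and that an unconditioned tree cut at
  height h has mean waste (1 - o(1)) h.

  For the first point, marks (the increments of the walk) are put on the
  vertices, so that tree and walk together form one Bienayme tree.  Given a
  finite marked tree c, the sum of law(t) z^|t| r^(number of copies of c in t)
  satisfies the recursion of the branching process up to a negative term due to
  c, and stays below 1 for some z > 1 and r < 1.  Having size N with too few
  copies of c is therefore exponentially unlikely ([fringe_concentration]).
  Having size N is not: its probability is supermultiplicative up to a
  constant (graft one tree on a leaf of another), and criticality prevents it
  from decaying geometrically ([size_law_subexponential]).  So conditioning on
  the size preserves the first estimate.

  For the second point, let a_h(x) be the probability that x is visited before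
  generation h ([hit]), so that the mean range is the mass M_h of a_h.  A
  Bienayme tree branches, and hits are then counted with repetition: with kappa
  the probability of at least two children,
    a_(h+1) <= theta * (a_h - kappa a_h^2 + delta_0)   (convolution by theta),
  a discrete semilinear heat equation.  As M_h is nondecreasing in h,
  kappa times the sum of a_h^2 is at most 1 for every h.  Since a_h increases
  with h, a_h - a_H is small in l2 for all h >= H when H is large.  Now a_h has
  second moment O(h^2), as theta is centered, so up to a small proportion of h
  its mass lies at distance O(sqrt h), where Z^4 has O(h^2) points.  By
  Cauchy-Schwarz the mass of a_h - a_H there is a small multiple of h, whence
  M_h = o(h) ([mean_range_sublinear]). *)

(** * Sums of nonnegative families *)

Ltac nneg :=
  intros; rewrite -?EFinM -?EFinD ?lee_fin;
  repeat first [done | exact: sqr_ge0 | apply: mulr_ge0 | apply: addr_ge0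
               | apply: exprn_ge0].

Lemma esum_scale (R : realType) (T : choiceType) (S : set T) (c : R)
    (a : T -> \bar R) : 0 <= c -> (forall x, S x -> 0 <= a x)%E ->
  (\esum_(x in S) (c%:E * a x) = c%:E * \esum_(x in S) a x)%E.
Proof.
move=> c0 a0; rewrite /esum -ereal_supZl//; last first.
  apply/set0P; exists 0%E, set0; first exact: fsets_set0.
  by rewrite fsbig_set0.
have sumE A : fsets S A ->
    (\sum_(x \in A) (c%:E * a x) = c%:E * \sum_(x \in A) a x)%E.
  case=> fA AS; rewrite !fsbig_finite// !big_seq ge0_sume_distrr// => x.
  by rewrite in_fset_set// inE => /AS /a0.
congr ereal_sup; apply/seteqP; split=> [_ [A fA <-]|_ [_ [A fA <-] <-]] /=.
  by exists (\sum_(x \in A) a x)%E; [exists A | rewrite sumE].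
by exists A => //; rewrite sumE.
Qed.

Lemma esum_subset (R : realType) (T : choiceType) (A B : set T)
    (a : T -> \bar R) : A `<=` B -> (forall x, B x -> 0 <= a x)%E ->
  (\esum_(x in A) a x <= \esum_(x in B) a x)%E.
Proof.
move=> AB a0; rewrite (esumID A B) // setIidr // leeDl // esum_ge0 //.
by move=> x [] /a0.
Qed.

Lemma esum_exchange (R : realType) (T U : choiceType) (a : T -> U -> \bar R) :
  (forall x y, 0 <= a x y)%E ->
  (\esum_(x in setT) \esum_(y in setT) a x y =
   \esum_(y in setT) \esum_(x in setT) a x y)%E.
Proof.
move=> a0; rewrite !esum_esum //.
rewrite (reindex_esum (setT `*`` (fun=> setT)) _ (fun p => (p.2, p.1))) //.
split=> [[x y]|[x y] [x' y'] _ _ /= [-> ->]|[x y] _] //=.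
by exists (y, x).
Qed.

Lemma esum_single (R : realType) (T : choiceType) (z : T) (F : T -> \bar R) :
  (forall x, x != z -> F x = 0)%E -> (0 <= F z)%E ->
  (\esum_(x in setT) F x = F z)%E.
Proof.
move=> F0 Fz; rewrite (esumID [set z] setT); last first.
  by move=> x _; have [->//|/F0->] := eqVneq x z.
rewrite setTI esum_set1 // esum1 ?adde0 // => x [_ /= /eqP] xz; exact: F0.
Qed.

Lemma esum_bij (R : realType) (T U : choiceType) (e : T -> U)
    (F : U -> \bar R) : bijective e ->
  (\esum_(y in setT) F y = \esum_(x in setT) F (e x))%E.
Proof.
case=> g eK gK; apply: reindex_esum; split => // [x y _ _|y _].
  exact: (can_inj eK).
by exists (g y).
Qed.

(** Used to split a sum over trees into a sum over the root and a sum over the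
  sequence of subtrees. *)
Lemma esum_constructor (R : realType) (X Y Z : choiceType) (c : X -> Y -> Z)
    (F : Z -> \bar R) :
  (forall x x' y y', c x y = c x' y' -> x = x' /\ y = y') ->
  (forall z, exists x y, z = c x y) -> (forall z, 0 <= F z)%E ->
  (\esum_(z in setT) F z =
   \esum_(x in setT) \esum_(y in setT) F (c x y))%E.
Proof.
move=> cI cS F0; rewrite esum_esum //.
apply: (reindex_esum (setT `*`` (fun=> setT)) setT (fun p => c p.1 p.2)).
split=> // [[x y] [x' y'] _ _ /= /cI [-> ->]//|z _].
by have [x [y ->]] := cS z; exists (x, y).
Qed.

Lemma esum_length (R : realType) (X : choiceType) (F : seq X -> \bar R) :
  (forall s, 0 <= F s)%E ->
  (\esum_(s in setT) F s =
   \esum_(k in setT) \esum_(s in [set s | size s = k]) F s)%E.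
Proof.
move=> F0; rewrite -esum_bigcupT //.
  by congr esum; apply/seteqP; split=> // s _; exists (size s).
by move=> i j _ _ [s [/= <- <-]].
Qed.

Lemma esum_length0 (R : realType) (X : choiceType) (F : seq X -> \bar R) :
  (forall s, 0 <= F s)%E -> (\esum_(s in [set s | size s = 0%N]) F s = F [::])%E.
Proof.
move=> F0; rewrite -[RHS](@esum_set1 R _ [::] F) //.
by congr esum; apply/seteqP; split=> s /=; [move=> /size0nil | move=> ->].
Qed.

Lemma esum_lengthS (R : realType) (X : choiceType) k (F : seq X -> \bar R) :
  (forall s, 0 <= F s)%E ->
  (\esum_(s in [set s | size s = k.+1]) F s =
   \esum_(x in setT) \esum_(s in [set s | size s = k]) F (x :: s))%E.
Proof.
move=> F0; rewrite esum_esum //.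
apply: (reindex_esum _ _ (fun p => p.1 :: p.2)).
split=> [[x s] /= [_ ->]//|[x s] [x' s'] _ _ /= [-> ->]//|[|x s]//= [sk]].
by exists (x, s).
Qed.

Section SeqSums.
Variables (R : realType) (X : choiceType) (a : X -> R).
Hypothesis a_ge0 : forall x, 0 <= a x.

Lemma esum_length_prod (A : R) (k : nat) :
  (\esum_(x in setT) (a x)%:E = A%:E)%E ->
  (\esum_(s in [set s | size s = k]) (\prod_(x <- s) a x)%:E = (A ^+ k)%:E)%E.
Proof.
move=> aA; have p0 s : (0 <= (\prod_(x <- s) a x)%:E)%E.
  by rewrite lee_fin prodr_ge0.
elim: k => [|k IH]; first by rewrite esum_length0 // big_nil expr0.
have A0 : 0 <= A by rewrite -lee_fin -aA esum_ge0 // => x _; rewrite lee_fin.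
rewrite esum_lengthS //; under eq_esum => x _.
  under eq_esum => s _ do rewrite big_cons EFinM.
  rewrite esum_scale // IH muleC; over.
by rewrite esum_scale ?exprn_ge0// ?aA ?exprSr// => x _; rewrite lee_fin.
Qed.

(** The branching property in generating-function form: with w the offspring
  law, a multiplicative functional of the children turns the sum A of one child
  into the generating function of w at A. *)
Lemma esum_seq_prod (A : R) (w : nat -> R) : (forall k, 0 <= w k) ->
  (\esum_(x in setT) (a x)%:E = A%:E)%E ->
  (\esum_(s in setT) (w (size s) * \prod_(x <- s) a x)%:E =
   \esum_(k in setT) (w k * A ^+ k)%:E)%E.
Proof.
move=> w0 aA; rewrite esum_length; last first.
  by move=> s; rewrite lee_fin mulr_ge0 // prodr_ge0.
apply: eq_esum => k _.
transitivity (\esum_(s in [set s | size s = k])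
    ((w k)%:E * (\prod_(x <- s) a x)%:E)%E)%E.
  by apply: eq_esum => s /= ->; rewrite EFinM.
rewrite esum_scale ?(esum_length_prod _ aA) // => s _.
by rewrite lee_fin prodr_ge0.
Qed.

(** As the weights a have mass 1, an additive functional has the same mean as k
  times its value on a single item. *)
Lemma esum_length_prod_sum (b : X -> R) (B : R) (k : nat) :
  (forall x, 0 <= b x) ->
  (\esum_(x in setT) (a x)%:E = 1)%E ->
  (\esum_(x in setT) (a x * b x)%:E = B%:E)%E ->
  (\esum_(s in [set s | size s = k])
     (\prod_(x <- s) a x * \sum_(x <- s) b x)%:E = (k%:R * B)%:E)%E.
Proof.
move=> b0 a1 abB; have p0 s : 0 <= \prod_(x <- s) a x by exact: prodr_ge0.
have s0 s : 0 <= \sum_(x <- s) b x by exact: sumr_ge0.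
elim: k => [|k IH].
  by rewrite esum_length0 ?big_nil ?mulr0 ?mul0r // => s; rewrite lee_fin mulr_ge0.
rewrite esum_lengthS; last by move=> s; rewrite lee_fin mulr_ge0.
have B0 : 0 <= B by rewrite -lee_fin -abB esum_ge0 // => x _; rewrite lee_fin mulr_ge0.
transitivity (\esum_(x in setT) ((a x * b x)%:E + (a x)%:E * (k%:R * B)%:E))%E.
  apply: eq_esum => x _; rewrite -IH -esum_scale //; last first.
    by move=> s _; rewrite lee_fin mulr_ge0.
  have := esum_length_prod k a1; rewrite expr1n => prod1.
  rewrite -[X in (X + _)%E]mule1 -[X in (_ * X + _)%E]prod1.
  rewrite -esum_scale ?mulr_ge0 //; last first.
    by move=> s _; rewrite lee_fin.
  rewrite -esumD; first last.
  - by move=> s _; rewrite -EFinM lee_fin !mulr_ge0.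
  - by move=> s _; rewrite -EFinM lee_fin !mulr_ge0.
  apply: eq_esum => s _; rewrite !big_cons -!EFinM -EFinD; congr EFin; ring.
rewrite esumD; first last.
- by move=> x _; rewrite -EFinM lee_fin !mulr_ge0.
- by move=> x _; rewrite lee_fin mulr_ge0.
rewrite abB; under eq_esum => x _ do rewrite muleC.
rewrite esum_scale ?mulr_ge0 //; last by move=> x _; rewrite lee_fin.
by rewrite a1 mule1 -EFinD; congr EFin; rewrite -natr1; ring.
Qed.

Lemma esum_seq_prod_sum (b : X -> R) (B : R) (w : nat -> R) :
  (forall k, 0 <= w k) -> (forall x, 0 <= b x) ->
  (\esum_(x in setT) (a x)%:E = 1)%E ->
  (\esum_(x in setT) (a x * b x)%:E = B%:E)%E ->
  (\esum_(s in setT) (w (size s) * \prod_(x <- s) a x * \sum_(x <- s) b x)%:E =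
   \esum_(k in setT) (w k * (k%:R * B))%:E)%E.
Proof.
move=> w0 b0 a1 abB.
have p0 s : 0 <= \prod_(x <- s) a x by exact: prodr_ge0.
have s0 s : 0 <= \sum_(x <- s) b x by exact: sumr_ge0.
rewrite esum_length; last by move=> s; rewrite lee_fin !mulr_ge0.
apply: eq_esum => k _.
transitivity (\esum_(s in [set s | size s = k])
    ((w k)%:E * (\prod_(x <- s) a x * \sum_(x <- s) b x)%:E)%E)%E.
  by apply: eq_esum => s /= ->; rewrite -EFinM mulrA.
rewrite esum_scale ?(esum_length_prod_sum k b0 a1 abB) // => s _.
by rewrite lee_fin mulr_ge0.
Qed.

End SeqSums.


(** * Discrete probability measures *)

Lemma measure_countable_bigcup (R : realType) d (O : measurableType d)
    (P : probability O R) (I : choiceType) (D : set I) (E : I -> set O) :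
  countable [set: I] -> (forall i, measurable (E i)) -> trivIset setT E ->
  (P (\bigcup_(i in D) E i) = \esum_(i in D) P (E i))%E.
Proof.
move=> /countable_injP[g gI] mE tE.
have cl n : D `&` g @^-1` [set n] = set0 \/
    exists2 i, D i /\ g i = n & D `&` g @^-1` [set n] = [set i].
  have [[i [Di gi]]|no] := pselect (exists i, D i /\ g i = n).
    right; exists i => //; apply/seteqP; split=> [j /= [_ gj]|_ -> //=].
    by apply: gI; rewrite ?inE // gj.
  by left; apply/seteqP; split=> // i [Di gi]; apply: no; exists i.
have mF n : measurable (\bigcup_(i in D `&` g @^-1` [set n]) E i).
  by case: (cl n) => [->|[i _ ->]]; rewrite ?bigcup_set0 ?bigcup_set1.
have DE : D = \bigcup_(n in setT) (D `&` g @^-1` [set n]).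
  by apply/seteqP; split=> [i Di|i [n _ []]//]; exists (g i).
rewrite {1}DE bigcup_bigcup measure_bigcup //; last first.
  move=> m n _ _ [w [[i [_ /= gi] Ei] [j [_ /= gj] Ej]]].
  by rewrite -gi -gj (tE i j) //; exists w.
under eq_eseriesl => n do rewrite in_setT.
rewrite nneseries_esumT // [in RHS]DE esum_bigcupT //; last first.
  by move=> m n _ _ [i [[_ /= <-] [_ /= <-]]].
apply: eq_esum => n _; case: (cl n) => [->|[i _ ->]].
  by rewrite bigcup_set0 measure0 esum_set0.
by rewrite bigcup_set1 esum_set1.
Qed.

(** Expectations on a countable discrete space are turned into sums once and
  for all; the rest of the proof only handles sums. *)
Lemma integral_discrete (R : realType) d (T : measurableType d)
    (P : probability T R) (f : T -> R) :
  countable [set: T] -> (forall A : set T, measurable A) ->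
  (forall x, 0 <= f x) ->
  (\int[P]_x (f x)%:E = \esum_(x in setT) (f x * fine (P [set x]))%:E)%E.
Proof.
move=> /countable_injP[g gI] mT f0.
have cl n : g @^-1` [set n] = set0 \/ exists i, g @^-1` [set n] = [set i].
  have [[i gi]|no] := pselect (exists i, g i = n).
    right; exists i => //; apply/seteqP; split=> [j /= gj|_ -> //=].
    by apply: gI; rewrite ?inE // gj.
  by left; apply/seteqP; split=> // i gi; apply: no; exists i.
have TE : [set: T] = \bigcup_n g @^-1` [set n].
  by apply/seteqP; split=> // i _; exists (g i).
rewrite TE ge0_integral_bigcup //; first last.
- by move=> m n _ _ [i [/= <- /= <-]].
- by move=> x _; rewrite lee_fin.
rewrite nneseries_esumT; last first.
  by move=> n; apply: integral_ge0 => x _; rewrite lee_fin.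
rewrite esum_bigcupT; first last.
- by move=> x; rewrite lee_fin mulr_ge0 // fine_ge0.
- by move=> m n _ _ [i [/= <- /= <-]].
apply: eq_esum => n _; case: (cl n) => [->|[i ->]].
  by rewrite integral_set0 esum_set0.
rewrite esum_set1 ?lee_fin ?mulr_ge0 ?fine_ge0 //.
transitivity (\int[P]_(x in [set i]) (f i)%:E)%E.
  by apply: eq_integral => x; rewrite inE => ->.
by rewrite integral_cst // EFinM fineK // fin_num_measure.
Qed.

Lemma discrete_mass (R : realType) d (T : measurableType d)
    (P : probability T R) :
  countable [set: T] -> (forall A : set T, measurable A) ->
  (\esum_(x in setT) (fine (P [set x]))%:E = 1)%E.
Proof.
move=> cT mT; have := integral_discrete P cT mT (fun=> ler01).
rewrite integral_cst // [X in (_ * X)%E]probability_setT mul1e => ->.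
by apply: eq_esum => x _; rewrite mul1r.
Qed.


(** * Critical offspring laws *)

Definition genfun (R : realType) (m : nat -> R) (A : R) : \bar R :=
  (\esum_(k in setT) (m k * A ^+ k)%:E)%E.

Lemma bernoulli (R : realType) (A : R) k : 0 <= A -> 1 + k%:R * A <= A ^+ k + k%:R.
Proof.
move=> A0; elim: k => [|k IH]; first by rewrite expr0 mul0r addr0.
have : 0 <= (A - 1) * (A ^+ k - 1).
  have [A1|/ltW A1] := leP 1 A.
    by rewrite mulr_ge0 ?subr_ge0 ?exprn_ege1.
  by rewrite mulr_le0 ?subr_le0 ?exprn_ile1.
rewrite exprS -natr1; move: (A ^+ k) IH => B; nra.
Qed.

(** The gain s^2 over the Bernoulli inequality appears as soon as k is at least
  two: this is where branching enters. *)
Lemma bernoulli_quad (R : realType) (s : R) k : 0 <= s <= 1 ->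
  1 + (2 <= k)%N%:R * s ^+ 2 <= (1 - s) ^+ k + k%:R * s.
Proof.
move=> /andP[s0 s1]; case: k => [|[|k]]; rewrite ?expr0 ?expr1 /=; try lra.
elim: k => [|k IH]; first by rewrite /=; nra.
have : 0 <= s * (1 - (1 - s) ^+ k.+2).
  by rewrite mulr_ge0 // subr_ge0 exprn_ile1; lra.
rewrite [(1 - s) ^+ k.+3]exprS -[k.+3%:R]natr1.
move: ((1 - s) ^+ k.+2) IH => B /=; nra.
Qed.

(** kappa is the probability of having at least two children, so that its
  positivity excludes the point mass at one. *)
Record critical_weights (R : realType) (m : nat -> R) (kappa : R) : Prop := {
  cw_ge0 : forall k, 0 <= m k;
  cw_mass : (\esum_(k in setT) (m k)%:E = 1)%E;
  cw_mean : (\esum_(k in setT) (m k * k%:R)%:E = 1)%E;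
  cw_branch : (\esum_(k in setT) (m k * (2 <= k)%N%:R)%:E = kappa%:E)%E;
  cw_gt0 : 0 < kappa
}.

Section CriticalWeights.
Variables (R : realType) (m : nat -> R) (kappa : R).
Hypothesis cw : critical_weights m kappa.
Let m0 := cw_ge0 cw.

Lemma genfun_ge0 A : 0 <= A -> (0 <= genfun m A)%E.
Proof. by move=> A0; rewrite esum_ge0 // => k _; rewrite lee_fin mulr_ge0 // exprn_ge0. Qed.

Lemma genfun1 : genfun m 1 = 1%E.
Proof.
by rewrite -(cw_mass cw); apply: eq_esum => k _; rewrite expr1n mulr1.
Qed.

Lemma le_genfun A B : 0 <= A -> A <= B -> (genfun m A <= genfun m B)%E.
Proof.
move=> A0 AB; apply: le_esum => k _; rewrite lee_fin ler_wpM2l // lerXn2r //.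
by rewrite nnegrE (le_trans A0).
Qed.

Lemma genfun_le1 A : 0 <= A <= 1 -> (genfun m A <= 1)%E.
Proof. by move=> /andP[A0 A1]; rewrite -genfun1 le_genfun. Qed.

(** A convex function lies above its tangent at 1, which is the diagonal
  because the mean is 1. *)
Lemma genfun_ge_id A : 0 <= A -> (A%:E <= genfun m A)%E.
Proof.
move=> A0; suff : (1 + A%:E <= genfun m A + 1)%E.
  by rewrite addeC leeD2rE.
rewrite -{1}(cw_mass cw) -[A%:E]mule1 -(cw_mean cw) -esum_scale //; last first.
  by move=> k _; rewrite lee_fin mulr_ge0.
rewrite -!esumD; try by nneg.
apply: le_esum => k _; rewrite -EFinM -!EFinD lee_fin.
have := ler_wpM2l (m0 k) (bernoulli k A0); lra.
Qed.

(** Quantitative convexity at 1: it forces extinction and, later, the loss of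
  mass of hitting probabilities at the rate kappa times their square. *)
Lemma genfun_quad s : 0 <= s <= 1 ->
  ((1 - s + kappa * s ^+ 2)%:E <= genfun m (1 - s))%E.
Proof.
move=> s01; have /andP[s0 s1] := s01; have s1' : 0 <= 1 - s by lra.
suff : (1 + (s ^+ 2)%:E * kappa%:E <= genfun m (1 - s) + s%:E)%E.
  have : (genfun m (1 - s) <= 1)%E by apply: genfun_le1; lra.
  have : (0 <= genfun m (1 - s))%E by apply: genfun_ge0; lra.
  case: (genfun m (1 - s)) => // g _ _.
  by rewrite -EFinM -!EFinD !lee_fin; lra.
rewrite -{1}(cw_mass cw) -(cw_branch cw) -[s%:E]mule1 -(cw_mean cw).
rewrite -!esum_scale ?sqr_ge0 //; first last.
- by move=> k _; rewrite lee_fin mulr_ge0.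
- by move=> k _; rewrite lee_fin mulr_ge0.
rewrite -!esumD; try by nneg.
apply: le_esum => k _; rewrite -!EFinM -!EFinD lee_fin.
have := ler_wpM2l (m0 k) (bernoulli_quad k s01); lra.
Qed.

(** At mean 1, branching has to be compensated by death. *)
Lemma kappa_le_m0 : kappa <= m 0%N.
Proof.
have : (1 + kappa%:E <= 1 + (m 0%N)%:E)%E.
  rewrite -{1}(cw_mass cw) -(cw_branch cw) -(cw_mean cw).
  have {1}-> : ((m 0%N)%:E = \esum_(k in setT) (m k * (k == 0%N)%:R)%:E)%E.
    rewrite (esum_single (z := 0%N)) ?eqxx ?mulr1 ?lee_fin // => k /negPf ->.
    by rewrite mulr0.
  rewrite -!esumD; try by nneg.
  apply: le_esum => k _; rewrite -!EFinD lee_fin.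
  rewrite -{1}[m k]mulr1 -!mulrDr ler_wpM2l // -(natrD _ 1) -natrD ler_nat.
  by case: k => [|[|k]].
by rewrite leeD2lE // lee_fin.
Qed.

Lemma m0_gt0 : 0 < m 0%N.
Proof. exact: lt_le_trans (cw_gt0 cw) kappa_le_m0. Qed.

Lemma m0_le1 : m 0%N <= 1.
Proof.
rewrite -lee_fin -(cw_mass cw) -[leLHS](@esum_set1 R _ 0%N (fun k => (m k)%:E)).
  by apply: esum_subset => // k _; rewrite lee_fin.
by rewrite lee_fin.
Qed.

End CriticalWeights.

Lemma critical_offspring (R : realType) (mu : probability nat R) :
  critical mu -> exists kappa, critical_weights (fun k => fine (mu [set k])) kappa.
Proof.
move=> [mean ndirac]; have cN : countable [set: nat] by [].
have mN (A : set nat) : measurable A by [].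
have m0 k : 0 <= fine (mu [set k]) by rewrite fine_ge0.
have mass := discrete_mass mu cN mN.
have mean1 : (\esum_(k in setT) (fine (mu [set k]) * k%:R)%:E = 1)%E.
  rewrite -mean unlock integral_discrete //.
  by apply: eq_esum => k _; rewrite mulrC.
have b0 k : (0 <= (fine (mu [set k]) * (2 <= k)%N%:R)%:E)%E by rewrite lee_fin mulr_ge0.
have : (\esum_(k in setT) (fine (mu [set k]) * (2 <= k)%N%:R)%:E <= 1)%E.
  rewrite -mass; apply: le_esum => k _; rewrite lee_fin ler_piMr //.
  by case: (2 <= k)%N.
have : (0 <= \esum_(k in setT) (fine (mu [set k]) * (2 <= k)%N%:R)%:E)%E.
  exact: esum_ge0.
case kE : (\esum_(k in _) _)%E => [kappa||] //; rewrite !lee_fin => k0 k1.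
exists kappa; split => //; rewrite lt_neqAle k0 andbT eq_sym; apply/eqP => kz.
have mz k : (2 <= k)%N -> fine (mu [set k]) = 0.
  move=> k2; apply/eqP; rewrite eq_le m0 andbT.
  rewrite -lee_fin -kz -kE -[leLHS]mule1 -{1}[1%E]/(true%:R%:E) -k2 -EFinM.
  rewrite -[leLHS](@esum_set1 R _ k (fun k => (fine (mu [set k]) * (2 <= k)%N%:R)%:E)) //.
  exact: esum_subset.
have mu1 : mu [set 1%N] = 1%E.
  rewrite -mean1 (esum_single (z := 1%N)) ?mulr1 ?lee_fin ?fineK ?fin_num_measure //.
  by move=> [|[|k]] // _; rewrite ?mulr0 // mz // mul0r.
apply: ndirac; apply/funext => A; rewrite diracE.
have [A1|A1] := boolP (1%N \in A).
  apply/eqP; rewrite eq_le probability_le1 //= -mu1 le_measure ?inE // => _ ->.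
  by rewrite inE in A1.
have mu1C : mu (~` [set 1%N]) = 0%E.
  by rewrite probability_setC ?[X in (1 - X)%E]mu1 ?subee //; exact: mN.
have : (mu A <= mu (~` [set 1%N]))%E.
  rewrite le_measure ?inE // => k Ak /= kE1.
  by move: A1; rewrite notin_setE -kE1.
by rewrite mu1C measure_le0 => /eqP ->.
Qed.


(** * Marked trees *)

Inductive mtree (X : Type) : Type := MNode of X & seq (mtree X).

Section MTree.
Variable X : Type.

Definition mark (t : mtree X) := let: MNode x _ := t in x.
Definition kids (t : mtree X) := let: MNode _ s := t in s.

Fixpoint msize (t : mtree X) : nat :=
  let: MNode _ s := t in (sumn (map msize s)).+1.

Fixpoint fringe (t : mtree X) : seq (mtree X) :=
  let: MNode _ s := t in t :: flatten (map fringe s).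

Fixpoint mtree_encode (t : mtree X) : GenTree.tree X :=
  let: MNode x s := t in
  GenTree.Node 0 (GenTree.Leaf x :: map mtree_encode s).

Fixpoint mtree_decode (g : GenTree.tree X) : option (mtree X) :=
  match g with
  | GenTree.Node _ (GenTree.Leaf x :: s) =>
      Some (MNode x (pmap mtree_decode s))
  | _ => None
  end.

Lemma mtree_encodeK : pcancel mtree_encode mtree_decode.
Proof.
rewrite /pcancel; fix IH 1; case=> x s /=; congr (Some (MNode x _)).
by elim: s => [//|t s IHs] /=; rewrite IH /= IHs.
Qed.

Lemma mtree_ind_Forall (P : mtree X -> Prop) :
  (forall x s, List.Forall P s -> P (MNode x s)) -> forall t, P t.
Proof.
move=> H; fix IH 1; case=> x s; apply: H.
by elim: s => [|t s IHs]; constructor.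
Qed.

Lemma msizeE x s : msize (MNode x s) = (\sum_(t <- s) msize t).+1.
Proof. by rewrite /= sumnE big_map. Qed.

Lemma msize_gt0 t : (0 < msize t)%N.
Proof. by case: t. Qed.

End MTree.

HB.instance Definition _ (X : eqType) :=
  Equality.copy (mtree X) (pcan_type (@mtree_encodeK X)).
HB.instance Definition _ (X : choiceType) :=
  Choice.copy (mtree X) (pcan_type (@mtree_encodeK X)).
HB.instance Definition _ (X : countType) :=
  Countable.copy (mtree X) (pcan_type (@mtree_encodeK X)).

Lemma mtree_ind_kids (X : eqType) (P : mtree X -> Prop) :
  (forall x s, (forall t, t \in s -> P t) -> P (MNode x s)) -> forall t, P t.
Proof.
move=> H; apply: mtree_ind_Forall => x s Fs; apply: H.
elim: Fs => // t {}s Pt _ IH u; rewrite inE => /predU1P[->//|]; exact: IH.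
Qed.

Lemma msize_kid (X : eqType) x s (t : mtree X) :
  t \in s -> (msize t < msize (MNode x s))%N.
Proof. by move=> ts; rewrite msizeE ltnS (big_rem t) //= leq_addr. Qed.

Lemma msize_fringe (X : eqType) (t u : mtree X) :
  u \in fringe t -> (msize u <= msize t)%N.
Proof.
elim/mtree_ind_kids: t => x s IH; rewrite inE => /predU1P[->//|].
move=> /flattenP[_ /mapP[v vs ->] /(IH _ vs) uv].
exact: leq_trans uv (ltnW (msize_kid x vs)).
Qed.

Lemma count_fringe (X : eqType) (c : mtree X) x s :
  (count_mem c (fringe (MNode x s)) =
   (MNode x s == c) + \sum_(t <- s) count_mem c (fringe t))%N.
Proof.
by rewrite /= count_flatten sumnE !big_map.
Qed.

(** A tree is not a proper subtree of itself; in the exponential moment below,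
  this makes the copies of c under a root of type c disappear. *)
Lemma count_fringe_small (X : eqType) (c t : mtree X) :
  (msize t < msize c)%N -> count_mem c (fringe t) = 0%N.
Proof.
move=> tc; apply/count_memPn/negP => /msize_fringe.
by rewrite leqNgt tc.
Qed.

Lemma esum_mtree (R : realType) (X : choiceType) (F : mtree X -> \bar R) :
  (forall t, 0 <= F t)%E ->
  (\esum_(t in setT) F t = \esum_(x in setT) \esum_(s in setT) F (MNode x s))%E.
Proof.
apply: esum_constructor => [x x' s s' [-> ->]//|[x s]].
by exists x, s.
Qed.

Lemma esum_le_size (R : realType) (T : choiceType) (sz : T -> nat)
    (f : T -> R) (B : \bar R) : (forall t, 0 <= f t) ->
  (forall N, \esum_(t in setT) (f t * (sz t <= N)%N%:R)%:E <= B)%E ->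
  (\esum_(t in setT) (f t)%:E <= B)%E.
Proof.
move=> f0 fB; apply: ge_ereal_sup => _ [A [fA _] <-].
apply: le_trans; last exact: (fB (\max_(t <- fset_set A) sz t)%N).
apply: esum_ge; exists A; first by split.
apply: lee_fsum => // t At; rewrite lee_fin.
rewrite (_ : (_ <= _)%N = true) ?mulr1 //.
by apply: leq_bigmax_seq => //; rewrite in_fset_set // mem_set.
Qed.

Section MLaw.
Variables (R : realType) (X : choiceType) (theta : X -> R) (m : nat -> R).
Variable kappa : R.
Hypothesis theta_ge0 : forall x, 0 <= theta x.
Hypothesis theta_mass : (\esum_(x in setT) (theta x)%:E = 1)%E.
Hypothesis cw : critical_weights m kappa.
Let m_ge0 := cw_ge0 cw.

Fixpoint mlaw (t : mtree X) : R :=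
  let: MNode x s := t in theta x * m (size s) * \prod_(p <- map mlaw s) p.

Lemma mlawE x s :
  mlaw (MNode x s) = theta x * (m (size s) * \prod_(t <- s) mlaw t).
Proof. by rewrite /= big_map mulrA. Qed.

Lemma mlaw_ge0 t : 0 <= mlaw t.
Proof.
elim/mtree_ind_kids: t => x s IH; rewrite mlawE !mulr_ge0 //.
by rewrite big_seq prodr_ge0.
Qed.
Hint Resolve mlaw_ge0 : core.

(** The factors of the children may depend on the mark of the root: this is
  needed for hitting probabilities, where the mark displaces the target. *)
Lemma esum_mlaw_prod (c : X -> R) (f : X -> mtree X -> R) (A : X -> R) :
  (forall x, 0 <= c x) -> (forall x t, 0 <= f x t) ->
  (forall x, \esum_(t in setT) (mlaw t * f x t)%:E = (A x)%:E)%E ->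
  (\esum_(t in setT)
      (mlaw t * (c (mark t) * \prod_(u <- kids t) f (mark t) u))%:E =
   \esum_(x in setT) ((theta x * c x)%:E * genfun m (A x)))%E.
Proof.
move=> c0 f0 fA; have p0 x s : 0 <= \prod_(u <- s) f x u by rewrite prodr_ge0.
rewrite esum_mtree; last by nneg.
apply: eq_esum => x _.
rewrite /genfun -(esum_seq_prod _ m_ge0 (fA x)); last by nneg.
rewrite -esum_scale ?mulr_ge0 //; last first.
  by move=> s _; rewrite lee_fin mulr_ge0 ?prodr_ge0 // => t _; rewrite mulr_ge0.
apply: eq_esum => s _; rewrite -EFinM mlawE big_split /=; congr EFin; ring.
Qed.

Lemma esum_mlaw_prod_const (f : mtree X -> R) (A : R) : (forall t, 0 <= f t) ->
  (\esum_(t in setT) (mlaw t * f t)%:E = A%:E)%E ->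
  (\esum_(t in setT) (mlaw t * \prod_(u <- kids t) f u)%:E = genfun m A)%E.
Proof.
move=> f0 fA.
have := @esum_mlaw_prod (fun=> 1) (fun=> f) (fun=> A).
move=> /(_ (fun=> ler01) (fun=> f0) (fun=> fA)).
under [X in X = _ -> _]eq_esum => t _ do rewrite mul1r.
move=> ->; under eq_esum => x _ do rewrite mulr1 muleC.
have A0 : 0 <= A by rewrite -lee_fin -fA esum_ge0 //; nneg.
have := genfun_ge0 cw A0; case: (genfun m A) => [g||] // g0.
  by rewrite esum_scale ?theta_mass ?mule1 //; nneg.
have [x tx] : exists x, 0 < theta x.
  apply: contrapT => no; suff : (1 = 0 :> \bar R)%E by move/eqP; rewrite gt_eqF ?lte01.
  rewrite -theta_mass esum1 // => x _.
  congr EFin; apply/eqP; rewrite eq_le theta_ge0 andbT leNgt.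
  by apply/negP => tx; apply: no; exists x.
apply/eqP; rewrite -leye_eq.
apply: (@le_trans _ _ (+oo * (theta x)%:E)%E); first by rewrite gt0_mulye.
rewrite -[leLHS](@esum_set1 R _ x (fun x => +oo * (theta x)%:E)%E).
  by apply: esum_subset => // y _; rewrite mule_ge0 ?lee_fin.
by rewrite gt0_mulye.
Qed.

(** By induction on N, the trees of size at most N have mass at most 1: the
  children of a tree of size at most N+1 have size at most N. *)
Lemma mlaw_mass_le1 : (\esum_(t in setT) (mlaw t)%:E <= 1)%E.
Proof.
apply: (@esum_le_size _ _ (@msize X)) => //; elim=> [|N IH].
  rewrite esum1 ?lee01 // => t _.
  by rewrite leqNgt msize_gt0 mulr0.
have E0 : (0 <= \esum_(t in setT) (mlaw t * (msize t <= N)%N%:R)%:E)%E.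
  by apply: esum_ge0; nneg.
move: IH E0; case E : (\esum_(t in _) _)%E => [A||] //.
rewrite !lee_fin => A1 A0.
apply: (@le_trans _ _ (genfun m A)); last by rewrite (genfun_le1 cw) // A0.
rewrite -(esum_mlaw_prod_const _ E) //.
apply: le_esum => -[x s] _; rewrite lee_fin ler_wpM2l // [kids _]/=.
have [sN|_] := boolP (_ < _)%N; last by rewrite prodr_ge0.
rewrite big_seq big1 // => t ts.
by have := leq_trans (msize_kid x ts) sN; rewrite ltnS => ->.
Qed.

(** The mass e is a fixed point of the generating function, and [genfun_quad]
  leaves no other one than 1 in the unit interval. *)
Lemma mlaw_mass : (\esum_(t in setT) (mlaw t)%:E = 1)%E.
Proof.
have e0 : (0 <= \esum_(t in setT) (mlaw t)%:E)%E.
  by apply: esum_ge0 => t _; rewrite lee_fin.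
move: mlaw_mass_le1 e0; case E : (\esum_(t in _) _)%E => [e||] //.
rewrite !lee_fin => e1 e0; congr EFin.
have E' : (\esum_(t in setT) (mlaw t * 1)%:E = e%:E)%E.
  by rewrite -E; apply: eq_esum => t _; rewrite mulr1.
have := esum_mlaw_prod_const (fun=> ler01) E'.
under eq_esum => t _ do rewrite big1_eq mulr1.
rewrite E => eE; have := @genfun_quad _ _ _ cw (1 - e).
rewrite (_ : 1 - (1 - e) = e); last by ring.
rewrite -eE lee_fin.
have e01 : 0 <= 1 - e <= 1 by lra.
move=> /(_ e01) q; apply/eqP; rewrite eq_sym -subr_eq0 -sqrf_eq0.
rewrite eq_le sqr_ge0 andbT -(pmulr_rle0 _ (cw_gt0 cw)); lra.
Qed.

Lemma mlaw_le1 t : mlaw t <= 1.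
Proof.
rewrite -lee_fin -mlaw_mass -[leLHS](@esum_set1 R _ t (fun t => (mlaw t)%:E)).
  by apply: esum_subset => // u _; rewrite lee_fin.
by rewrite lee_fin.
Qed.

(** Criticality: the children contribute on average once the mean of b. *)
Lemma esum_mlaw_sum (b : mtree X -> R) (B : R) : (forall t, 0 <= b t) ->
  (\esum_(t in setT) (mlaw t * b t)%:E = B%:E)%E ->
  (\esum_(t in setT) (mlaw t * (1 + \sum_(u <- kids t) b u))%:E = (1 + B)%:E)%E.
Proof.
move=> b0 bB; have s0 s : 0 <= \sum_(u <- s) b u by rewrite sumr_ge0.
have p0 s : 0 <= \prod_(u <- s) mlaw u by rewrite prodr_ge0.
have B0 : 0 <= B by rewrite -lee_fin -bB esum_ge0 //; nneg.
transitivity (\esum_(t in setT)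
   ((mlaw t)%:E + (mlaw t * \sum_(u <- kids t) b u)%:E))%E.
  by apply: eq_esum => t _; rewrite -EFinD mulrDr mulr1.
rewrite esumD; try by nneg.
rewrite mlaw_mass EFinD; congr (_ + _)%E.
rewrite esum_mtree; last by nneg.
transitivity (\esum_(x in setT) (B%:E * (theta x)%:E))%E; last first.
  by rewrite esum_scale ?theta_mass ?mule1 //; nneg.
apply: eq_esum => x _.
transitivity ((theta x)%:E * \esum_(s in setT)
    (m (size s) * \prod_(t <- s) mlaw t * \sum_(t <- s) b t)%:E)%E.
  rewrite -esum_scale //; last by nneg.
  by apply: eq_esum => s _; rewrite -EFinM mlawE !mulrA.
rewrite (esum_seq_prod_sum _ m_ge0 b0 mlaw_mass bB); last by nneg.
rewrite muleC; congr (_ * _)%E.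
transitivity (B%:E * \esum_(k in setT) (m k * k%:R)%:E)%E; last first.
  by rewrite (cw_mean cw) mule1.
rewrite -esum_scale //; last by nneg.
by apply: eq_esum => k _; rewrite -EFinM; congr EFin; ring.
Qed.

End MLaw.


(** * Exponential concentration of the fringe trees *)

Section Concentration.
Variables (R : realType) (X : choiceType) (theta : X -> R) (m : nat -> R).
Variable kappa : R.
Hypothesis theta_ge0 : forall x, 0 <= theta x.
Hypothesis theta_mass : (\esum_(x in setT) (theta x)%:E = 1)%E.
Hypothesis cw : critical_weights m kappa.
Let law := mlaw theta m.
Let law_ge0 t : 0 <= law t. Proof. exact: (mlaw_ge0 theta_ge0 cw). Qed.
Hint Resolve law_ge0 : core.

Definition tilt (z r : R) (c : mtree X) (N : nat) (t : mtree X) : R :=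
  z ^+ msize t * r ^+ count_mem c (fringe t) * (msize t <= N)%N%:R.

Lemma tilt_ge0 z r c N t : 0 <= z -> 0 <= r -> 0 <= tilt z r c N t.
Proof. by move=> z0 r0; rewrite /tilt; nneg. Qed.

(** Equality holds except at t = c.  There the copy of c at the root costs a
  factor r that the product over the children does not see, and the difference
  is at least z (1 - r) since z >= 1. *)
Lemma tilt_step z r c N t : 1 <= z -> 0 <= r <= 1 -> (msize c <= N.+1)%N ->
  tilt z r c N.+1 t + z * (1 - r) * (t == c)%:R <=
  z * \prod_(u <- kids t) tilt z r c N u.
Proof.
move=> z1 /andP[r0 r1] cN; have z0 : 0 <= z by lra.
have [tN|tN] := leqP (msize t) N.+1; last first.
  rewrite /tilt leqNgt tN mulr0 add0r.
  have -> : (t == c) = false by apply/eqP => tc; move: tN; rewrite tc ltnNge cN.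
  rewrite mulr0 mulr_ge0 // prodr_ge0 // => u _; exact: tilt_ge0.
case: t tN => x s tN; rewrite [kids _]/= /tilt tN mulr1.
rewrite count_fringe msizeE exprS exprD.
have -> : \prod_(u <- s)
    (z ^+ msize u * r ^+ count_mem c (fringe u) * (msize u <= N)%N%:R) =
    z ^+ (\sum_(u <- s) msize u) * r ^+ (\sum_(u <- s) count_mem c (fringe u)).
  rewrite !expr_sum -big_split /=; rewrite big_seq [RHS]big_seq.
  apply: eq_bigr => u us; have := leq_trans (msize_kid x us) tN.
  by rewrite ltnS => ->; rewrite mulr1.
have [tc|_] := eqVneq (MNode x s) c; last by rewrite expr0 mul1r mulr0 addr0 mulrA.
have -> : (\sum_(u <- s) count_mem c (fringe u) = 0)%N.
  by rewrite big_seq big1 // => u us; rewrite count_fringe_small // -tc msize_kid.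
rewrite expr0 expr1 !mulr1.
have P1 : 1 <= z ^+ (\sum_(t <- s) msize t) by rewrite exprn_ege1.
have P0 : 0 <= z ^+ (\sum_(t <- s) msize t) - 1 by lra.
have r1' : 0 <= 1 - r by lra.
have := mulr_ge0 (mulr_ge0 z0 r1') P0.
by move: (z ^+ _) => P; lra.
Qed.

Lemma esum_neq_mlaw c :
  (\esum_(t in setT) (law t * (t != c)%:R)%:E + (law c)%:E = 1)%E.
Proof.
rewrite -(mlaw_mass theta_ge0 theta_mass cw).
have {1}-> : ((law c)%:E = \esum_(t in setT) (law t * (t == c)%:R)%:E)%E.
  rewrite (esum_single (z := c)) ?eqxx ?mulr1 ?lee_fin // => t /negPf ->.
  by rewrite mulr0.
rewrite -esumD; try by nneg.
apply: eq_esum => t _; rewrite -EFinD -mulrDr -/law.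
by case: (t == c); rewrite /= ?addr0 ?add0r mulr1.
Qed.

(** z is tuned so that the factor z per vertex is paid for by the factor r per
  copy of c: if K is the sum for trees of size at most N, the sum for size at
  most N+1 is at most z genfun(K) - z (1 - r) law(c) <= z - (1 - r) law(c) = 1.
  The induction starts at sizes smaller than that of c, where c is missing and
  the mass 1 - law(c) leaves room for the factor z^|c|. *)
Lemma esum_tilt_le1 (c : mtree X) (r : R) : 0 <= r <= 1 ->
  (1 + (1 - r) * law c) ^+ msize c * (1 - law c) <= 1 ->
  forall N, (\esum_(t in setT)
    (law t * tilt (1 + (1 - r) * law c) r c N t)%:E <= 1)%E.
Proof.
move=> r01 zc; have /andP[r0 r1] := r01; set z := 1 + (1 - r) * law c in zc *.
have up0 : 0 <= (1 - r) * law c by rewrite mulr_ge0 // subr_ge0.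
have z1 : 1 <= z by rewrite /z; lra.
have z0 : 0 <= z by lra.
have T0 N t : 0 <= tilt z r c N t by exact: tilt_ge0.
have small N : (N < msize c)%N ->
    (\esum_(t in setT) (law t * tilt z r c N t)%:E <= 1)%E.
  move=> Nc; apply: (@le_trans _ _ (\esum_(t in setT)
     ((z ^+ msize c)%:E * (law t * (t != c)%:R)%:E))%E).
    apply: le_esum => t _; rewrite -EFinM lee_fin [leRHS]mulrCA ler_wpM2l //.
    rewrite /tilt; have [tN|_] := leqP (msize t) N; last by rewrite mulr0; nneg.
    have -> : t != c by apply/eqP => tc; move: Nc; rewrite ltnNge -tc tN.
    rewrite !mulr1 -[leRHS]mulr1 ler_pM ?exprn_ge0 //; last by rewrite exprn_ile1.
    by rewrite ler_weXn2l // (leq_trans tN) // ltnW.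
  rewrite esum_scale ?exprn_ge0 //; last by nneg.
  have := esum_neq_mlaw c; have : (0 <= \esum_(t in setT) (law t * (t != c)%:R)%:E)%E.
    by apply: esum_ge0; nneg.
  case: (\esum_(t in _) _)%E => [q||] // _ [qE].
  by rewrite -EFinM lee_fin (_ : q = 1 - law c) // -qE; ring.
elim=> [|N IH]; first exact/small/msize_gt0.
have [/small//|cN] := ltnP N.+1 (msize c).
have E0 M : (0 <= \esum_(t in setT) (law t * tilt z r c M t)%:E)%E.
  by apply: esum_ge0 => t _; rewrite lee_fin mulr_ge0.
move: IH (E0 N); case E : (\esum_(t in _) _)%E => [A||] //.
rewrite !lee_fin => A1 A0.
have gA : (genfun m A <= 1)%E by rewrite (genfun_le1 cw) // A0.
have prodE := esum_mlaw_prod_const theta_ge0 theta_mass cw (T0 N) E.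
have : (\esum_(t in setT) (law t * tilt z r c N.+1 t)%:E +
        (z * (1 - r) * law c)%:E <= z%:E * genfun m A)%E.
  have -> : ((z * (1 - r) * law c)%:E =
      \esum_(t in setT) (law t * (z * (1 - r) * (t == c)%:R))%:E)%E.
    rewrite (esum_single (z := c)) ?eqxx ?mulr1; first by rewrite mulrC.
      by move=> t /negPf ->; rewrite !mulr0.
    by rewrite lee_fin !mulr_ge0 // subr_ge0.
  rewrite -prodE -esum_scale //; last first.
    by move=> t _; rewrite lee_fin mulr_ge0 // prodr_ge0.
  rewrite -esumD; [|by move=> t _; rewrite lee_fin mulr_ge0|]; last first.
    by move=> t _; rewrite lee_fin !mulr_ge0 // subr_ge0.
  apply: le_esum => t _; rewrite -EFinM -EFinD lee_fin -mulrDr mulrCA.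
  by rewrite ler_wpM2l // tilt_step.
move: (genfun_ge0 cw A0) gA (E0 N.+1); case: (genfun m A) => [g||] // _.
case: (\esum_(t in _) _)%E => [K||] //.
rewrite !lee_fin => g1 _ H.
have : z * g <= z by rewrite ler_piMr.
have : (1 - r) * law c <= z * ((1 - r) * law c) by rewrite ler_peMl.
have : z = 1 + (1 - r) * law c by []; lra.
Qed.

(** With r = exp(-s), z = 1 + (1 - r) p behaves like exp(s p) as s tends to 0,
  hence beats exp(s (1 - eps) p) for small s.  The value s = eps / (4 n)
  serves both requirements. *)
Lemma exponential_choice (p eps : R) (n : nat) :
  0 < p <= 1 -> 0 < eps < 1 -> (0 < n)%N ->
  exists2 s : R, 0 < s & let z := 1 + (1 - expR (- s)) * p in
    z ^+ n * (1 - p) <= 1 /\ expR (s * ((1 - eps) * p)) < z.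
Proof.
move=> /andP[p0 p1] /andP[e0 e1] n0; have nR : 1 <= n%:R :> R by rewrite ler1n.
pose s := eps / (4 * n%:R); have n4 : 0 < 4 * n%:R :> R by lra.
have s0 : 0 < s by rewrite divr_gt0.
have sn : s * n%:R = eps / 4 by rewrite /s; field; lra.
have s4 : s <= eps / 4 by rewrite -sn ler_peMr // ltW.
clearbody s; exists s => //=; set u := 1 - expR (- s); pose y := u * p.
have us : u <= s by have := expR_ge1Dx (- s); rewrite /u; lra.
have su : s / (1 + s) <= u.
  rewrite /u expRN; have := expR_ge1Dx s => es.
  have : (expR s)^-1 <= (1 + s)^-1 by rewrite lef_pV2 // ?posrE ?expR_gt0 //; lra.
  by rewrite (_ : s / (1 + s) = 1 - (1 + s)^-1); [lra | field; lra].
have u0 : 0 < u by apply: lt_le_trans su; rewrite divr_gt0 //; lra.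
have y0 : 0 < y by rewrite mulr_gt0.
have ys : y <= s by rewrite /y (le_trans _ us) // ler_piMr // ltW.
split.
  have zn : (1 + u * p) ^+ n <= expR (n%:R * (u * p)).
    rewrite expRM_natl lerXn2r ?nnegrE ?expR_ge1Dx ?expR_ge0 //.
    by rewrite -/y; lra.
  apply: (@le_trans _ _ (expR (n%:R * (u * p)) * expR (- p))).
    have y1 : 0 <= 1 + u * p by rewrite -/y; lra.
    have p1' : 0 <= 1 - p by lra.
    by rewrite ler_pM ?exprn_ge0 ?expR_ge1Dx.
  rewrite -expRD -[leRHS]expR0 ler_expR.
  have : n%:R * (u * p) <= n%:R * (s * p) by rewrite !ler_wpM2l ?ler_wpM2r //; lra.
  have -> : n%:R * (s * p) = eps / 4 * p by rewrite -sn; ring.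
  have : eps / 4 * p <= p by rewrite ler_piMl //; lra.
  by lra.
apply: (@lt_le_trans _ _ (expR (y / (1 + y)))); last first.
  have := expR_ge1Dx (- (y / (1 + y))); rewrite expRN => h.
  have h1 : 1 + - (y / (1 + y)) = (1 + y)^-1 by field; lra.
  rewrite h1 lef_pV2 ?posrE ?expR_gt0 // in h; lra.
rewrite ltr_expR.
apply: (@lt_le_trans _ _ (s * p / (1 + s) / (1 + s))).
  have s1 : 0 < 1 + s by lra.
  rewrite ltr_pdivlMr // ltr_pdivlMr //.
  have -> : s * ((1 - eps) * p) * (1 + s) * (1 + s) =
    (s * p) * ((1 - eps) * (1 + s) ^+ 2) by ring.
  rewrite -[ltRHS]mulr1 ltr_pM2l ?mulr_gt0 //.
  have ss : (1 + s) ^+ 2 <= 1 + eps * (9 / 16) by rewrite expr2; nra.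
  apply: (@le_lt_trans _ _ ((1 - eps) * (1 + eps * (9 / 16)))).
    by rewrite ler_wpM2l //; lra.
  by nra.
apply: (@le_trans _ _ (y / (1 + s))).
  rewrite ler_wpM2r ?invr_ge0 //; first by lra.
  by rewrite /y mulrAC ler_wpM2r // ltW.
rewrite ler_wpM2l ?lef_pV2 ?posrE; lra.
Qed.

(** The exponential Markov inequality applied to the tilted sum
  [esum_tilt_le1]. *)
Lemma fringe_concentration (c : mtree X) (eps : R) : 0 < eps < 1 ->
  exists2 rho : R, 0 < rho < 1 & forall N,
    (\esum_(t in [set t | msize t = N /\
        ((count_mem c (fringe t))%:R < (1 - eps) * law c * N%:R)%R]) (law t)%:E <=
     (rho ^+ N)%:E)%E.
Proof.
move=> e01; have /andP[e0 e1] := e01.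
have p1 : law c <= 1 by exact: (mlaw_le1 theta_ge0 theta_mass cw).
have := law_ge0 c; rewrite le_eqVlt => /predU1P[pE|p0].
  exists 2^-1 => [|N]; first by lra.
  rewrite (_ : [set t | _] = set0) ?esum_set0 ?lee_fin ?exprn_ge0 ?invr_ge0 //.
  apply/seteqP; split=> // t [_]; rewrite -pE mulr0 mul0r ltNge => /negP; apply.
  exact: ler0n.
have p01 : 0 < law c <= 1 by rewrite p0 p1.
have [s s0 /= [zc ez]] := exponential_choice p01 e01 (msize_gt0 c).
set r := expR (- s) in zc ez; set z := 1 + _ in zc ez.
have r0 : 0 < r by rewrite expR_gt0.
have r01 : 0 <= r <= 1.
  by rewrite ltW //= /r -[leRHS]expR0 ler_expR; lra.
have K1 := esum_tilt_le1 r01 zc; rewrite -/z in K1.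
have z0 : 0 < z by exact: lt_trans (expR_gt0 _) ez.
exists (expR (s * ((1 - eps) * law c)) / z).
  by rewrite divr_gt0 ?expR_gt0 //= ltr_pdivrMr // mul1r.
move=> N; set rho := _ / z.
have rho0 : 0 < rho by rewrite divr_gt0 ?expR_gt0.
have rho0' := ltW rho0.
apply: (@le_trans _ _ ((rho ^+ N)%:E * 1)%E); last by rewrite mule1.
apply: (@le_trans _ _
  ((rho ^+ N)%:E * \esum_(t in setT) (law t * tilt z r c N t)%:E)%E); last first.
  by rewrite lee_wpmul2l ?lee_fin ?exprn_ge0 // ltW.
have T0 t : 0 <= tilt z r c N t by apply: tilt_ge0; exact: ltW.
rewrite -esum_scale ?exprn_ge0 ?(ltW rho0) //; last by nneg.
rewrite [leLHS]esum_mkcond; apply: le_esum => t _.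
case: ifPn => [|_]; last by nneg.
move=> /set_mem[tN ct]; rewrite -EFinM lee_fin mulrCA ler_peMr //.
rewrite /tilt tN leqnn mulr1 /rho expr_div_n.
rewrite mulrA -[X in X * _]mulrA mulVf ?expf_neq0 ?gt_eqF // mulr1.
rewrite -expRM_natl /r -expRM_natl -expRD -[leLHS]expR0 ler_expR.
have : s * (count_mem c (fringe t))%:R <= s * ((1 - eps) * law c * N%:R).
  by rewrite ler_wpM2l ?ltW.
by lra.
Qed.

End Concentration.


(** * The size law decays slower than any exponential *)

Lemma esum_geometric_le (R : realType) (x : R) : 0 <= x < 1 ->
  (\esum_(k in setT) (x ^+ k)%:E <= ((1 - x)^-1)%:E)%E.
Proof.
move=> /andP[x0 x1]; rewrite -nneseries_esumT; last by nneg.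
apply: lime_le; first by apply: is_cvg_nneseries; nneg.
apply: nearW => n; rewrite big_mkord sumEFin lee_fin.
rewrite -[leRHS]mul1r ler_pdivlMr ?subr_gt0 // mulrC.
have := subrX1 x n; have : 0 <= x ^+ n by exact: exprn_ge0.
by move: (x ^+ n) (\sum_(i < n) _) => a b; lra.
Qed.

Fixpoint unmark (X : Type) (t : mtree X) : tree :=
  let: MNode _ s := t in Node (map (@unmark X) s).

(** The vertices of t are words: x gives the mark of each of them, and the
  subtree of the i-th child reads its marks at the words that begin with i. *)
Fixpoint decorate (X : Type) (t : tree) (x : seq nat -> X) : mtree X :=
  let: Node s := t in
  MNode (x [::])
    [seq p.2 (fun u => x (p.1 :: u))
    | p <- zip (iota 0 (size s)) (map (@decorate X) s)].

Lemma tree_ind_subtrees (P : tree -> Prop) :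
  (forall s, (forall t, t \in s -> P t) -> P (Node s)) -> forall t, P t.
Proof.
move=> H; have H' s : List.Forall P s -> P (Node s).
  move=> Fs; apply: H; elim: Fs => // t {}s Pt _ IH u.
  by rewrite inE => /predU1P[->//|]; exact: IH.
fix IH 1; case=> s; apply: H'.
by elim: s => [|t s IHs]; constructor.
Qed.

Lemma zip_iotaE (A B : Type) (a0 : A) (f : nat * A -> B) (s : seq A) :
  map f (zip (iota 0 (size s)) s) =
  mkseq (fun i => f (i, nth a0 s i)) (size s).
Proof.
apply: (@eq_from_nth _ (f (0%N, a0))).
  by rewrite size_map size_zip size_iota minnn size_mkseq.
move=> i; rewrite size_map size_zip size_iota minnn => il.
rewrite (nth_map (0%N, a0)) ?size_zip ?size_iota ?minnn //.
by rewrite nth_zip ?size_iota // nth_iota // nth_mkseq.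
Qed.

Lemma decorateE (X : Type) s (x : seq nat -> X) :
  decorate (Node s) x = MNode (x [::])
    (mkseq (fun i => decorate (nth (Node [::]) s i) (fun u => x (i :: u))) (size s)).
Proof.
rewrite /=; congr MNode; rewrite -(size_map (@decorate X) s).
rewrite (zip_iotaE (@decorate X (Node [::]))) size_map.
apply/eq_in_map => i; rewrite mem_iota /= => il.
by rewrite (nth_map (Node [::])).
Qed.

Lemma verticesE s : vertices (Node s) =
  [::] :: flatten (mkseq (fun i =>
            map (cons i) (vertices (nth (Node [::]) s i))) (size s)).
Proof.
rewrite /= -(size_map vertices s) (zip_iotaE [::]) size_map; congr (_ :: flatten _).
by apply/eq_in_map => i; rewrite mem_iota /= => il; rewrite (nth_map (Node [::])).
Qed.

Lemma unmark_decorate (X : Type) t (x : seq nat -> X) : unmark (decorate t x) = t.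
Proof.
elim/tree_ind_subtrees: t x => s IH x; rewrite decorateE /=; congr Node.
rewrite -[RHS](mkseq_nth (Node [::])) /mkseq -map_comp.
apply/eq_in_map => i; rewrite mem_iota /= => il.
by rewrite IH // mem_nth.
Qed.

Lemma decorate_unmark (t : mtree unit) (x : seq nat -> unit) :
  decorate (unmark t) x = t.
Proof.
elim/mtree_ind_kids: t x => y s IH x; rewrite [unmark _]/= decorateE.
case: (x _) y => -[]; congr MNode.
rewrite -[RHS](mkseq_nth (MNode tt [::])) size_map.
apply/eq_in_map => i; rewrite mem_iota /= => il.
by rewrite (nth_map (MNode tt [::])) // IH // mem_nth.
Qed.

Lemma msize_decorate (X : Type) t (x : seq nat -> X) :
  msize (decorate t x) = size (vertices t).
Proof.
elim/tree_ind_subtrees: t x => s IH x.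
rewrite decorateE verticesE /= size_flatten /shape -map_comp; congr (sumn _).+1.
rewrite /mkseq -map_comp; apply/eq_in_map => i; rewrite mem_iota /= => il.
by rewrite IH ?mem_nth // size_map.
Qed.

Section Decorated.
Variables (R : realType) (mu : probability nat R) (X : choiceType).
Variable theta : X -> R.
Let m k := fine (mu [set k]).

Lemma mlaw_decorate t (x : seq nat -> X) :
  mlaw theta m (decorate t x) =
  bienayme_law mu t * \prod_(u <- vertices t) theta (x u).
Proof.
elim/tree_ind_subtrees: t x => s IH x.
rewrite decorateE mlawE verticesE big_cons size_mkseq.
rewrite [bienayme_law _ _]/= big_map big_flatten /= !big_map.
rewrite [in X in _ = X * _](big_nth (Node [::])) big_mkord mulrCA -!mulrA.
congr (_ * _); rewrite mulrCA; congr (_ * _).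
have -> : iota 0 (size s) = index_iota 0 (size s) by rewrite /index_iota subn0.
rewrite !big_mkord -big_split /=.
by apply: eq_bigr => i _; rewrite IH ?mem_nth // big_map.
Qed.

End Decorated.

Lemma bij_decorate_unit : bijective (fun t : tree => decorate t (fun=> tt)).
Proof.
exists (@unmark unit) => t; first exact: unmark_decorate.
exact: decorate_unmark.
Qed.

Section Graft.
Variable X : eqType.

(** The leftmost leaf of t is replaced by u.  The leftmost branch of the result
  is strictly decreasing in size, so that the sizes of t and u determine the
  vertex at which u was grafted. *)
Fixpoint graft (t u : mtree X) : mtree X :=
  let: MNode x s := t in
  match s with
  | [::] => u
  | v :: s' => MNode x (graft v u :: s')
  end.

Lemma mtree_ind_first (P : mtree X -> Prop) :
  (forall x, P (MNode x [::])) ->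
  (forall x v s, P v -> P (MNode x (v :: s))) -> forall t, P t.
Proof.
move=> H0 HS; elim/mtree_ind_kids => x [|v s] IH; first exact: H0.
by apply: HS; apply: IH; rewrite mem_head.
Qed.

Lemma msize_graft t u : (msize (graft t u)).+1 = (msize t + msize u)%N.
Proof.
elim/mtree_ind_first: t => [x|x v s IH]; first by rewrite /= add1n.
by rewrite [graft _ _]/= !msizeE !big_cons -addSn IH; lia.
Qed.

Lemma graft_inj t u t' u' : graft t u = graft t' u' -> msize t = msize t' ->
  (forall x y : X, x = y) -> t = t' /\ u = u'.
Proof.
move=> + + XE; elim/mtree_ind_first: t t' => [x|x v s IH] [y [|v' s']] //=.
- by move=> -> _; rewrite (XE x y).
- by move=> _ []; have := msize_gt0 v'; lia.
- by move=> _ []; have := msize_gt0 v; lia.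
- move=> [_ gE <-] [/addIn sE]; have [<- ->] := IH _ gE sE.
  by rewrite (XE x y).
Qed.

End Graft.

(** Unmarked trees are handled as trees with marks in the one-point type, to
  which the results on marked trees apply. *)
Section SizeLaw.
Variables (R : realType) (mu : probability nat R) (kappa : R).
Let m k := fine (mu [set k]).
Hypothesis cw : critical_weights m kappa.
Let law := mlaw (fun=> 1 : R) m : mtree unit -> R.
Let one_ge0 (x : unit) : 0 <= (1 : R). Proof. by []. Qed.
Let law_ge0 t : 0 <= law t. Proof. exact: (mlaw_ge0 one_ge0 cw). Qed.
Hint Resolve law_ge0 : core.

Let one_mass : (\esum_(x in [set: unit]) (1 : R)%:E = 1)%E.
Proof. by rewrite (esum_single (z := tt)) ?lee_fin // => -[]. Qed.

Lemma size_lawE N : bienayme_size_law mu N =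
  fine (\esum_(t in [set t : mtree unit | msize t = N]) (law t)%:E)%E.
Proof.
congr fine; symmetry; apply: etrans.
  apply: (reindex_esum [set t | size (vertices t) = N] _
    (fun t : tree => decorate t (fun=> tt))).
  split=> [t|t t' _ _|t /= tN].
  - by rewrite /= msize_decorate.
  - exact: (bij_inj bij_decorate_unit).
  - exists (unmark t); last exact: decorate_unmark.
    by rewrite /= -tN -{2}(decorate_unmark t (fun=> tt)) msize_decorate.
by apply: eq_esum => t _; rewrite /law mlaw_decorate big1_eq mulr1.
Qed.

Lemma size_law_EFin N :
  (\esum_(t in [set t : mtree unit | msize t = N]) (law t)%:E =
   (bienayme_size_law mu N)%:E)%E.
Proof.
rewrite size_lawE fineK // ge0_fin_numE; last first.
  by apply: esum_ge0 => t _; rewrite lee_fin.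
apply: (@le_lt_trans _ _ 1%E); last exact: ltry.
rewrite -(mlaw_mass one_ge0 one_mass cw).
by apply: esum_subset => // t _; rewrite lee_fin.
Qed.

Lemma size_law_ge0 N : 0 <= bienayme_size_law mu N.
Proof.
by rewrite -lee_fin -size_law_EFin esum_ge0 // => t _; rewrite lee_fin.
Qed.

Lemma size_law_le1 N : bienayme_size_law mu N <= 1.
Proof.
rewrite -lee_fin -size_law_EFin -(mlaw_mass one_ge0 one_mass cw).
by apply: esum_subset => // t _; rewrite lee_fin.
Qed.

Lemma size_law0 : bienayme_size_law mu 0 = 0.
Proof.
rewrite size_lawE (_ : [set t | _] = set0) ?esum_set0 //.
by apply/seteqP; split=> // -[].
Qed.

Lemma mlaw_graft t u : m 0%N * law (graft t u) = law t * law u.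
Proof.
elim/mtree_ind_first: t => [x|x v s IH].
  by rewrite [graft _ _]/= {2}/law mlawE big_nil mul1r mulr1.
rewrite [graft _ _]/= /law !mlawE !big_cons -/law /= !mul1r.
by rewrite mulrCA !mulrA -[X in X * _ = _]mulrA IH; ring.
Qed.

Lemma size_law_supermult N M :
  bienayme_size_law mu N.+1 * bienayme_size_law mu M.+1 <=
  m 0%N * bienayme_size_law mu (N + M).+1.
Proof.
set A := [set t : mtree unit | msize t = N.+1].
set B := [set t : mtree unit | msize t = M.+1].
have pairs : (\esum_(k in A `*`` (fun=> B)) (law k.1 * law k.2)%:E =
    (bienayme_size_law mu N.+1 * bienayme_size_law mu M.+1)%:E)%E.
  rewrite -(@esum_esum _ _ _ A (fun=> B) (fun t u => (law t * law u)%:E)); last first.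
    by move=> t u _ _; rewrite lee_fin mulr_ge0.
  transitivity (\esum_(t in A) ((bienayme_size_law mu M.+1)%:E * (law t)%:E))%E.
    apply: eq_esum => t _; rewrite -size_law_EFin muleC -esum_scale //.
    by move=> u _; rewrite lee_fin.
  rewrite esum_scale ?size_law_ge0 ?size_law_EFin 1?muleC //.
  by move=> t _; rewrite lee_fin.
rewrite -lee_fin -pairs EFinM -size_law_EFin.
under eq_esum => k _ do rewrite -mlaw_graft EFinM.
rewrite esum_scale; last 2 first.
- exact: cw_ge0 cw _.
- by move=> k _; rewrite lee_fin.
rewrite lee_wpmul2l ?lee_fin //; first exact: cw_ge0 cw _.
rewrite -(esum_image _ (fun k => graft k.1 k.2) (fun t => (law t)%:E)); last first.
  move=> [t u] [t' u'] /set_mem[/= tA _] /set_mem[/= tA' _] /= gE.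
  by have [||-> ->] := graft_inj gE; [rewrite tA tA' | case=> -[] |].
apply: esum_subset => [_ [[t u] [/= tN uM] <-]|t _]; last by rewrite lee_fin.
by rewrite /=; have := msize_graft t u; rewrite tN uM addSn addnS => -[].
Qed.

(** Otherwise the size would have a finite exponential moment H of base z > 1.
  The recursion H = z genfun(H) and the inequality genfun(H) >= H, due to
  criticality, would give H >= z H > H. *)
Lemma size_law_not_geometric (rho : R) : 0 < rho < 1 ->
  exists2 N, (0 < N)%N & m 0%N * rho ^+ N <= bienayme_size_law mu N.+1.
Proof.
move=> /andP[r0 r1]; apply: contrapT => no.
have sl N : bienayme_size_law mu N <= rho^-1 * rho ^+ N.
  case: N => [|[|N]]; first by rewrite size_law0 expr0 mulr1 invr_ge0 ltW.
    by rewrite expr1 mulVf ?gt_eqF // size_law_le1.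
  rewrite exprS mulrA mulVf ?gt_eqF // mul1r.
  have [//|/ltW/le_trans] := leP (m 0%N * rho ^+ N.+1) (bienayme_size_law mu N.+2).
    by move=> h; exfalso; apply: no; exists N.+1.
  by apply; rewrite ler_piMl ?(m0_le1 cw) ?exprn_ge0 ?(ltW r0).
(* Any z with 1 < z < 1 / rho would do. *)
pose z := 2 / (1 + rho).
have z0 : 0 < z by rewrite divr_gt0 //; lra.
have z1 : 1 < z by rewrite /z ltr_pdivlMr; lra.
have zr : 0 <= rho * z < 1.
  rewrite mulr_ge0 ?ltW //= /z mulrA ltr_pdivrMr; lra.
clearbody z; have L0 (t : mtree unit) : 0 <= law t * z ^+ msize t.
  by rewrite mulr_ge0 // exprn_ge0 // ltW.
have Hle : (\esum_(t in setT) (law t * z ^+ msize t)%:E <=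
            (rho^-1 * (1 - rho * z)^-1)%:E)%E.
  rewrite (_ : setT = \bigcup_n [set t : mtree unit | msize t = n]); last first.
    by apply/seteqP; split=> // t _; exists (msize t).
  rewrite esum_bigcupT; first last.
  - by move=> t; rewrite lee_fin.
  - by move=> i j _ _ [t [/= <- <-]].
  apply: (@le_trans _ _ (\esum_(n in setT) ((rho^-1)%:E * ((rho * z) ^+ n)%:E))%E).
    apply: le_esum => n _; apply: (@le_trans _ _
        (\esum_(t in [set t : mtree unit | msize t = n]) ((z ^+ n)%:E * (law t)%:E))%E).
      by apply: le_esum => t /= ->; rewrite -EFinM mulrC.
    rewrite esum_scale ?exprn_ge0 ?(ltW z0) //; last first.
      by move=> t _; rewrite lee_fin.
    rewrite size_law_EFin -!EFinM lee_fin exprMn mulrA [leRHS]mulrC.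
    by rewrite ler_wpM2l ?exprn_ge0 ?(ltW z0).
  rewrite esum_scale ?invr_ge0 ?(ltW r0) //; last first.
    by move=> n _; rewrite lee_fin exprn_ge0 //; case/andP: zr.
  by rewrite EFinM lee_wpmul2l ?lee_fin ?invr_ge0 ?(ltW r0) // esum_geometric_le.
have Hge : ((law (MNode tt [::]) * z ^+ 1)%:E <=
            \esum_(t in setT) (law t * z ^+ msize t)%:E)%E.
  rewrite -(@esum_set1 R _ (MNode tt [::]) (fun t => (law t * z ^+ msize t)%:E)).
    by apply: esum_subset => // t _; rewrite lee_fin.
  by rewrite lee_fin.
move: Hle Hge; case E : (\esum_(t in _) _)%E => [H||] // _.
rewrite lee_fin expr1 => Hge.
have H0 : 0 < H.
  apply: lt_le_trans Hge; rewrite mulr_gt0 // /law mlawE big_nil mul1r mulr1.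
  exact: m0_gt0 cw.
have f0 (t : mtree unit) : 0 <= z ^+ msize t by rewrite exprn_ge0 // ltW.
have := esum_mlaw_prod_const one_ge0 one_mass cw f0 E => gE.
have := genfun_ge_id cw (ltW H0); rewrite -gE.
have : (z%:E * (\esum_(t in setT)
    (law t * (\prod_(u <- kids t) z ^+ msize u)%R)%:E) = H%:E)%E.
  rewrite -E -esum_scale ?(ltW z0) //; last first.
    by move=> t _; rewrite lee_fin mulr_ge0 // prodr_ge0.
  apply: eq_esum => -[x s] _; rewrite -EFinM mulrCA; congr (_ * _)%:E.
  by rewrite msizeE exprS expr_sum.
case: (\esum_(t in _) _)%E => [g|/=|/=]; last 2 first.
- by rewrite gt0_muley ?lte_fin.
- by [].
rewrite -EFinM => -[HE]; rewrite lee_fin => zg.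
have g0 : 0 < g by rewrite -(pmulr_rgt0 _ z0) HE.
by have : g < z * g; [rewrite ltr_pMl | rewrite HE; lra].
Qed.

(** Fekete's argument.  Fix n with v(n) >= rho^n; the support of v may be
  periodic, so one starts, in each residue class modulo n, from the least b with
  v(b) > 0 and adds n repeatedly. *)
Lemma size_law_subexponential (rho : R) : 0 < rho < 1 ->
  exists2 c : R, 0 < c & forall N, 0 < bienayme_size_law mu N.+1 ->
    c * rho ^+ N <= bienayme_size_law mu N.+1.
Proof.
move=> r01; have /andP[r0 r1] := r01.
have mp : 0 < m 0%N by exact: m0_gt0 cw.
have [n n0 vn] := size_law_not_geometric r01.
set v := fun N => bienayme_size_law mu N.+1 in vn *.
have step N : v N * rho ^+ n <= v (N + n)%N.
  rewrite -(ler_pM2l mp); apply: le_trans (size_law_supermult N n).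
  by rewrite mulrCA ler_wpM2l ?size_law_ge0.
have iter q N : v N * rho ^+ (q * n) <= v (N + q * n)%N.
  elim: q => [|q IH]; first by rewrite mul0n addn0 expr0 mulr1.
  have -> : (N + q.+1 * n = N + q * n + n)%N by rewrite mulSn; lia.
  apply: le_trans (step _); rewrite mulSn exprD mulrCA mulrC.
  by rewrite ler_wpM2r ?exprn_ge0 ?(ltW r0).
suff H k : (k <= n)%N -> exists2 c : R, 0 < c &
    forall N, (N %% n < k)%N -> 0 < v N -> c * rho ^+ N <= v N.
  have [c c0 cP] := H n (leqnn n); exists c => // N; apply: cP.
  by rewrite ltn_mod.
elim: k => [|k IH] kn; first by exists 1.
have [c c0 cP] := IH (ltnW kn).
have [ex|no] := pselect (exists N, ((N %% n)%N == k) && (0 < v N)); last first.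
  exists c => // N; rewrite ltnS leq_eqVlt => /orP[Nk vN|Nk]; last exact: cP.
  by exfalso; apply: no; exists N; rewrite Nk vN.
have [b /andP[/eqP bk vb] bmin] := ex_minnP ex.
exists (Num.min c (v b)) => [|N]; first by rewrite lt_min c0 vb.
rewrite ltnS leq_eqVlt => /orP[/eqP Nk vN|Nk vN]; last first.
  apply: le_trans (cP _ Nk vN); rewrite ler_wpM2r ?exprn_ge0 ?(ltW r0) //.
  by rewrite ge_min lexx.
have bN : (b <= N)%N by apply: bmin; rewrite Nk eqxx vN.
have NE : N = (b + (N %/ n - b %/ n) * n)%N.
  rewrite mulnBl [in LHS](divn_eq N n) {1}(divn_eq b n) Nk bk.
  have := leq_mul (leq_div2r n bN) (leqnn n).
  by move: (N %/ n * n)%N (b %/ n * n)%N => x y; lia.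
rewrite {2}NE; apply: le_trans (iter _ _).
rewrite ler_pM ?exprn_ge0 ?(ltW r0) // ?le_min ?(ltW c0) ?(ltW vb) //.
  by rewrite ge_min lexx orbT.
by rewrite ler_wiXn2l ?(ltW r0) ?(ltW r1) // {2}NE leq_addl.
Qed.

End SizeLaw.


(** * Wasted vertices *)

(** The patterns in S are distinct, so that an entry of s is counted for at most
  one of them. *)
Lemma sum_count_le (T : eqType) (S s : seq T) (f : T -> nat) : uniq S ->
  (\sum_(c <- S) count_mem c s * f c <= \sum_(u <- s) f u)%N.
Proof.
move=> uS; elim: s => [|u s IH]; first by rewrite big1.
rewrite big_cons; under eq_bigr => c _ do rewrite [count_mem _ _]/= mulnDl.
rewrite big_split leq_add // {IH}.
elim: S uS => [|c S IH] /=; first by rewrite big_nil.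
move=> /andP[cS uS]; rewrite big_cons; have [uc|_] := eqVneq u c; last first.
  by rewrite mul0n IH.
rewrite mul1n uc big_seq big1 ?addn0 // => c' c'S.
by have [cc|] := eqVneq c c'; rewrite ?mul0n //; move: cS; rewrite cc c'S.
Qed.

Section Waste.
Variable V : zmodType.
Implicit Types (t : mtree V) (L : seq (nat * V)) (g : nat -> nat).

(** Depths and positions in depth-first order.  The mark of the root displaces
  the root itself: the walk starts from 0 just above it. *)
Fixpoint dvisits t : seq (nat * V) :=
  let: MNode y s := t in
  (0%N, y) :: [seq (p.1.+1, y + p.2) | p <- flatten (map dvisits s)].

Definition shallow (h : nat) L : seq V := [seq p.2 | p <- L & (p.1 < h)%N].

Definition visits h t : seq V := shallow h (dvisits t).

Definition positions t : seq V := map snd (dvisits t).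

Definition waste (s : seq V) : nat := (size s - size (undup s))%N.

(** The weight g depends on the depth and will count the ancestors that charge
  a wasted vertex. *)
Fixpoint weighted_waste g L : nat :=
  if L is p :: L' then
    ((p.2 \in map snd L') * g p.1 + weighted_waste g L')%N
  else 0%N.

Lemma waste_cons x s : waste (x :: s) = ((x \in s) + waste s)%N.
Proof.
rewrite /waste /=; have := size_undup s.
by case: (x \in s) => /= us; rewrite ?subSS ?subSn.
Qed.

Lemma weighted_wasteD g1 g2 L :
  weighted_waste (fun d => g1 d + g2 d)%N L =
  (weighted_waste g1 L + weighted_waste g2 L)%N.
Proof. by elim: L => //= p L ->; rewrite mulnDr; lia. Qed.

Lemma weighted_waste_le g1 g2 L : (forall d, g1 d <= g2 d)%N ->
  (weighted_waste g1 L <= weighted_waste g2 L)%N.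
Proof. by move=> g12; elim: L => //= p L IH; rewrite leq_add // leq_mul. Qed.

Lemma weighted_wasteM k L :
  weighted_waste (fun=> k) L = (k * waste (map snd L))%N.
Proof.
by elim: L => [|p L /= ->]; rewrite ?muln0 //= waste_cons mulnDr mulnC.
Qed.

(** Repetitions inside L1 or inside L2 are repetitions inside their
  concatenation. *)
Lemma weighted_waste_cat g L1 L2 :
  (weighted_waste g L1 + weighted_waste g L2 <= weighted_waste g (L1 ++ L2))%N.
Proof.
elim: L1 => //= p L1 IH; rewrite -addnA leq_add // leq_mul //.
by rewrite map_cat mem_cat; case: (_ \in _).
Qed.

Lemma weighted_waste_flatten g (Ls : seq (seq (nat * V))) :
  (\sum_(L <- Ls) weighted_waste g L <= weighted_waste g (flatten Ls))%N.
Proof.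
elim: Ls => [|L Ls IH]; first by rewrite big_nil.
rewrite big_cons /=; apply: leq_trans (weighted_waste_cat _ _ _).
by rewrite leq_add2l.
Qed.

Lemma weighted_waste_shift g y L :
  weighted_waste g [seq (p.1.+1, y + p.2) | p <- L] =
  weighted_waste (fun d => g d.+1) L.
Proof.
elim: L => //= p L ->; congr (_ * _ + _)%N; rewrite -map_comp.
by rewrite (map_comp (+%R y) snd) mem_map //; exact: addrI.
Qed.

Lemma waste_shallow h L :
  (waste (shallow h L) <= weighted_waste (fun d => (d < h)%N) L)%N.
Proof.
elim: L => // p L IH; rewrite /shallow /=.
case: (p.1 < h)%N; last by rewrite muln0.
rewrite /= waste_cons muln1 leq_add //.
have [/mapP[q]|//] := boolP (_ \in [seq q.2 | q <- _]).
by rewrite mem_filter => /andP[_ qL] ->; rewrite map_f.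
Qed.

(** A vertex at depth d has min(d + 1, h) ancestors (itself included) at
  distance less than h, and only these see it in their cut tree.  The induction
  rests on min(d + 2, h) = min(d + 1, h) + [d + 1 < h]. *)
Lemma sum_waste_fringe_weighted h t :
  (\sum_(u <- fringe t) waste (visits h u) <=
   weighted_waste (fun d => minn d.+1 h) (dvisits t))%N.
Proof.
elim/mtree_ind_kids: t => y s IH; rewrite [fringe _]/= big_cons.
have kids_le : (\sum_(u <- flatten (map (@fringe V) s)) waste (visits h u) <=
    weighted_waste (fun d => minn d.+1 h) (flatten (map dvisits s)))%N.
  apply: leq_trans (weighted_waste_flatten _ _); rewrite big_flatten /= !big_map.
  by rewrite big_seq [leqRHS]big_seq leq_sum.
apply: leq_trans (leq_add (waste_shallow h _) kids_le) _ => /=.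
rewrite !weighted_waste_shift -addnA leq_add //.
  by rewrite leq_mul //; case: (h) => [|[]].
rewrite -weighted_wasteD weighted_waste_le // => d; lia.
Qed.

Lemma sum_waste_fringe h t :
  (\sum_(u <- fringe t) waste (visits h u) <= h * waste (positions t))%N.
Proof.
apply: leq_trans (sum_waste_fringe_weighted h t) _.
rewrite -weighted_wasteM weighted_waste_le // => d; exact: geq_minr.
Qed.

Lemma size_positions t : size (positions t) = msize t.
Proof.
rewrite size_map; elim/mtree_ind_kids: t => x s IH.
rewrite msizeE /= size_map size_flatten /seq.shape -map_comp sumnE big_map.
by congr S; rewrite big_seq [RHS]big_seq; apply: eq_bigr => t /IH.
Qed.

Lemma visits0 t : visits 0 t = [::].
Proof. by rewrite /visits /shallow (eq_filter (a2 := pred0)) ?filter_pred0. Qed.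

Lemma visitsS h y s : visits h.+1 (MNode y s) =
  y :: [seq y + x | x <- flatten (map (visits h) s)].
Proof.
rewrite /visits /shallow /=; congr (_ :: _).
rewrite filter_map -!map_comp /=.
rewrite (_ : flatten (map _ s) =
  [seq p.2 | p <- flatten (map dvisits s) & (p.1 < h)%N]).
  by rewrite -map_comp; apply/eq_map.
by rewrite filter_flatten map_flatten -!map_comp.
Qed.

Lemma mem_visitsS h y s x : (x \in visits h.+1 (MNode y s)) =
  (x == y) || has (fun t => x - y \in visits h t) s.
Proof.
rewrite visitsS inE; congr (_ || _).
rewrite -{1}(subrK y x) addrC mem_map; last exact: addrI.
by elim: s => //= t s IH; rewrite mem_cat IH.
Qed.

Lemma size_visitsS h t : size (visits h.+1 t) =
  (1 + \sum_(u <- kids t) size (visits h u))%N.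
Proof.
case: t => y s; rewrite visitsS /= size_map size_flatten /seq.shape -map_comp.
by rewrite sumnE big_map add1n.
Qed.

Lemma mem_visits_le h t x : x \in visits h t -> x \in visits h.+1 t.
Proof.
rewrite /visits /shallow => /mapP[p]; rewrite mem_filter => /andP[ph pt] ->.
by rewrite map_f // mem_filter (leq_trans ph).
Qed.

End Waste.

Lemma positionsE (V : zmodType) (y : V) s :
  positions (MNode y s) = [seq y + x | x <- 0 :: flatten (map (@positions V) s)].
Proof.
have -> : flatten (map (@positions V) s) = map snd (flatten (map (@dvisits V) s)).
  by rewrite map_flatten -map_comp.
by rewrite /positions /= addr0 -!map_comp.
Qed.

Lemma size_undup_positions (V : zmodType) (y : V) s :
  size (undup (positions (MNode y s))) = size (undup (positions (MNode 0 s))).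
Proof.
have I z : injective (fun x : V => z + x) by exact: addrI.
by rewrite !positionsE !(undup_map_inj (I _)) !size_map.
Qed.

(** c is the place from which the increment of the root leads to W [::]; it
  becomes the position of the parent in the induction. *)
Lemma map_walk_vertices (V : zmodType) (t : tree) (x W : seq nat -> V) (c : V) :
  W [::] = c + x [::] ->
  (forall u, u \in vertices t -> u != [::] -> W u - W (parent u) = x u) ->
  map W (vertices t) = [seq c + p | p <- positions (decorate t x)].
Proof.
elim/tree_ind_subtrees: t x W c => s IH x W c W0 WE.
rewrite decorateE verticesE /positions /= W0; congr (_ :: _).
rewrite -!map_comp map_flatten map_flatten -!map_comp; congr flatten.
apply/eq_in_map => i; rewrite mem_iota /= => il; rewrite -!map_comp.
have := IH (nth (Node [::]) s i) (mem_nth _ il) (fun u => x (i :: u))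
  (fun u => W (i :: u)) (c + x [::]).
have step u : u \in vertices (nth (Node [::]) s i) ->
    W (i :: u) - W (parent (i :: u)) = x (i :: u).
  move=> uv; apply: WE => //; rewrite verticesE inE; apply/orP; right.
  apply/flattenP; exists (map (cons i) (vertices (nth (Node [::]) s i))).
    by apply/mapP; exists i => //; rewrite mem_iota.
  exact: map_f.
move=> H; rewrite [LHS]H /positions -?map_comp.
- by apply: eq_map => p /=; rewrite addrA.
- rewrite -(step [::]) ?W0; first by rewrite addrC subrK.
  by case: (nth _ s i) => ?; rewrite verticesE mem_head.
- by move=> [//|j u] uv _; rewrite -step.
Qed.


(** * The mean range of a tree cut at height h *)

Section ExpectedRange.
Variables (R : realType) (V : zmodType) (theta : V -> R) (m : nat -> R).
Variable kappa : R.
Hypothesis theta_ge0 : forall x, 0 <= theta x.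
Hypothesis theta_mass : (\esum_(x in setT) (theta x)%:E = 1)%E.
Hypothesis cw : critical_weights m kappa.
Let law := mlaw theta m.
Let law_ge0 t : 0 <= law t. Proof. exact: (mlaw_ge0 theta_ge0 cw). Qed.
Hint Resolve law_ge0 : core.
Let law_mass := mlaw_mass theta_ge0 theta_mass cw.

Definition hit (h : nat) (x : V) : R :=
  fine (\esum_(t in setT) (law t * (x \in visits h t)%:R)%:E)%E.

Lemma hitE h x :
  (\esum_(t in setT) (law t * (x \in visits h t)%:R)%:E = (hit h x)%:E)%E.
Proof.
rewrite /hit fineK // ge0_fin_numE; last by apply: esum_ge0; nneg.
apply: (@le_lt_trans _ _ 1%E); last exact: ltry.
rewrite -law_mass; apply: le_esum => t _; rewrite lee_fin ler_piMr //.
by case: (_ \in _).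
Qed.

Lemma hit_ge0 h x : 0 <= hit h x.
Proof. by rewrite -lee_fin -hitE esum_ge0 //; nneg. Qed.

Lemma hit_le1 h x : hit h x <= 1.
Proof.
rewrite -lee_fin -hitE -law_mass; apply: le_esum => t _; rewrite lee_fin ler_piMr //.
by case: (_ \in _).
Qed.
Hint Resolve hit_ge0 hit_le1 : core.

Lemma hit0 x : hit 0 x = 0.
Proof.
by rewrite /hit esum1 // => t _; rewrite visits0 mulr0.
Qed.

Lemma hit_leS h x : hit h x <= hit h.+1 x.
Proof.
rewrite -lee_fin -!hitE; apply: le_esum => t _; rewrite lee_fin ler_wpM2l //.
by case: (boolP (x \in visits h t)) => // /mem_visits_le ->.
Qed.

Lemma hit_le h k x : (h <= k)%N -> hit h x <= hit k x.
Proof.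
move=> /subnKC <-; elim: (k - h)%N => [|d IH]; first by rewrite addn0.
by rewrite addnS (le_trans IH) // hit_leS.
Qed.

Lemma missE h x :
  (\esum_(t in setT) (law t * (x \notin visits h t)%:R)%:E = (1 - hit h x)%:E)%E.
Proof.
have : (\esum_(t in setT) (law t * (x \notin visits h t)%:R)%:E +
        (hit h x)%:E = 1)%E.
  rewrite -hitE -law_mass -esumD; try by nneg.
  apply: eq_esum => t _; rewrite -EFinD -mulrDr.
  by case: (x \in _); rewrite ?add0r ?addr0 mulr1.
have : (0 <= \esum_(t in setT) (law t * (x \notin visits h t)%:R)%:E)%E.
  by apply: esum_ge0; nneg.
case: (\esum_(t in _) _)%E => [q||] // _ [qE]; congr EFin; rewrite -qE; ring.
Qed.

(** The probability that a tree whose root stands at 0 visits x before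
  generation h+1: either x is 0, or one of the trees of the children visits x,
  which fails with probability genfun(1 - hit h x). *)
Definition rooted_hit (h : nat) (x : V) : R :=
  1 - (x != 0)%:R * fine (genfun m (1 - hit h x)).

Let miss01 h x : 0 <= 1 - hit h x <= 1.
Proof. by have := hit_ge0 h x; have := hit_le1 h x; lra. Qed.

Let miss_ge0 h x : 0 <= 1 - hit h x.
Proof. by have /andP[] := miss01 h x. Qed.

Lemma genfun_missE h x :
  (genfun m (1 - hit h x) = (fine (genfun m (1 - hit h x)))%:E)%E.
Proof.
rewrite fineK // ge0_fin_numE ?(genfun_ge0 cw) //.
exact: le_lt_trans (genfun_le1 cw (miss01 h x)) (ltry _).
Qed.

Lemma genfun_miss01 h x : 0 <= fine (genfun m (1 - hit h x)) <= 1.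
Proof.
by rewrite -!lee_fin -genfun_missE (genfun_ge0 cw) // (genfun_le1 cw).
Qed.

Lemma rooted_hit_ge0 h x : 0 <= rooted_hit h x.
Proof.
rewrite subr_ge0; have /andP[g0 g1] := genfun_miss01 h x.
by rewrite mulr_ile1 //; case: (_ != _).
Qed.
Hint Resolve rooted_hit_ge0 : core.

(** The mark y of the root moves it from 0 to y; conditioning on y turns
  [rooted_hit] into its convolution with theta. *)
Lemma hitS h x :
  ((hit h.+1 x)%:E = \esum_(y in setT) (theta y * rooted_hit h (x - y))%:E)%E.
Proof.
have := @esum_mlaw_prod R V theta m kappa theta_ge0 cw
  (fun y => (x != y)%:R) (fun y t => (x - y \notin visits h t)%:R)
  (fun y => 1 - hit h (x - y)) (fun y => ler0n _ _) (fun y t => ler0n _ _)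
  (fun y => missE h (x - y)).
have -> : (\esum_(t in setT) (mlaw theta m t * ((x != mark t)%:R *
    \prod_(u <- kids t) (x - mark t \notin visits h u)%:R))%:E =
    \esum_(t in setT) (law t * (x \notin visits h.+1 t)%:R)%:E)%E.
  apply: eq_esum => -[y s] _; congr (_ * _)%:E; rewrite mem_visitsS negb_or.
  rewrite -mulnb natrM; congr (_ * _)%R.
  rewrite [mark _]/= [kids _]/=; elim: s => [|t s IH]; first by rewrite big_nil.
  by rewrite big_cons IH /= negb_or -mulnb natrM.
rewrite missE => missS.
have : ((hit h.+1 x)%:E + (1 - hit h.+1 x)%:E =
    \esum_(y in setT) (theta y * rooted_hit h (x - y))%:E + (1 - hit h.+1 x)%:E)%E.
  rewrite -EFinD addrC subrK missS.
  have g0 y : 0 <= fine (genfun m (1 - hit h (x - y))).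
    by case/andP: (genfun_miss01 h (x - y)).
  rewrite -esumD; first last.
  - by move=> y _; rewrite genfun_missE; nneg.
  - by nneg.
  rewrite -theta_mass; apply: eq_esum => y _.
  rewrite genfun_missE -EFinM -EFinD /rooted_hit subr_eq0; congr EFin; ring.
by move=> /(congr1 (fun z => (z - (1 - hit h.+1 x)%:E)%E)); rewrite !addeK.
Qed.

(** Outside 0 this is [genfun_quad]; at 0 the certain hit is paid for by the
  source term. *)
Lemma rooted_hit_le h x :
  rooted_hit h x + kappa * hit h x ^+ 2 <= hit h x + (x == 0)%:R.
Proof.
have h01 : 0 <= hit h x <= 1 by rewrite hit_ge0 hit_le1.
have := genfun_quad cw h01; rewrite genfun_missE lee_fin /rooted_hit.
have [->|_] := eqVneq x 0; last by rewrite /= mul1r; lra.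
rewrite /= mul0r subr0 => _; rewrite addrC lerD2r.
have k1 : kappa <= 1 by apply: le_trans (kappa_le_m0 cw) (m0_le1 cw).
have k0 := ltW (cw_gt0 cw); have a0 := hit_ge0 h 0; have a1 := hit_le1 h 0.
have : kappa * hit h 0 ^+ 2 <= 1 * hit h 0 ^+ 2 by rewrite ler_wpM2r // sqr_ge0.
have : hit h 0 ^+ 2 <= hit h 0 by rewrite expr2 ler_piMl.
lra.
Qed.

Lemma rooted_hit_le_hit h x : rooted_hit h x <= hit h x + (x == 0)%:R.
Proof.
apply: le_trans (rooted_hit_le h x).
by rewrite lerDl mulr_ge0 ?sqr_ge0 // ltW // (cw_gt0 cw).
Qed.

Lemma esum_convolution (F f : V -> R) :
  (forall x, 0 <= F x) -> (forall x, 0 <= f x) ->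
  (\esum_(x in setT) \esum_(y in setT) (F x * (theta y * f (x - y)%R))%:E =
   \esum_(z in setT) \esum_(y in setT) (f z * (theta y * F (y + z)%R))%:E)%E.
Proof.
move=> F0 f0; rewrite esum_exchange; last by nneg.
rewrite [RHS]esum_exchange; last by nneg.
apply: eq_esum => y _; rewrite (esum_bij (e := +%R y)); last first.
  by exists (fun x => - y + x) => x; rewrite ?addKr ?addNKr.
apply: eq_esum => z _; have -> : y + z - y = z by rewrite addrC addKr.
by congr EFin; ring.
Qed.

Lemma esum_hitS (F : V -> R) h : (forall x, 0 <= F x) ->
  (\esum_(x in setT) (hit h.+1 x * F x)%:E =
   \esum_(z in setT) \esum_(y in setT)
     (rooted_hit h z * (theta y * F (y + z)%R))%:E)%E.
Proof.
move=> F0; rewrite -esum_convolution //; apply: eq_esum => x _.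
rewrite mulrC EFinM hitS -esum_scale //; nneg.
Qed.

Lemma esum_hit_mass_step h : (\esum_(x in setT) (hit h.+1 x)%:E =
  \esum_(z in setT) (rooted_hit h z)%:E)%E.
Proof.
transitivity (\esum_(x in setT) (hit h.+1 x * 1)%:E)%E.
  by apply: eq_esum => x _; rewrite mulr1.
rewrite esum_hitS //; apply: eq_esum => z _.
transitivity ((rooted_hit h z)%:E * \esum_(y in setT) (theta y)%:E)%E.
  rewrite -esum_scale //; last by nneg.
  by apply: eq_esum => y _; rewrite mulr1.
by rewrite theta_mass mule1.
Qed.

Lemma esum_delta0 (c : R) : 0 <= c ->
  (\esum_(x in [set: V]) (c * (x == 0)%:R)%:E = c%:E)%E.
Proof.
move=> c0; rewrite (esum_single (z := 0)) ?eqxx ?mulr1 ?lee_fin // => x /negPf ->.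
by rewrite mulr0.
Qed.

(** Convolution with theta preserves the mass, so [rooted_hit_le] sums to a
  balance: what enters at 0 is at most 1 per generation, and branching removes
  kappa times the sum of squares. *)
Lemma mean_range_recursion h :
  (\esum_(x in setT) (hit h.+1 x)%:E +
   kappa%:E * (\esum_(x in setT) (hit h x ^+ 2)%:E) <=
   \esum_(x in setT) (hit h x)%:E + 1)%E.
Proof.
have k0 := ltW (cw_gt0 cw).
rewrite esum_hit_mass_step -esum_scale //; last by nneg.
rewrite -[in leRHS](esum_delta0 ler01) -!esumD; try by nneg.
by apply: le_esum => x _; rewrite -EFinM -!EFinD lee_fin mul1r rooted_hit_le.
Qed.

Lemma mean_range_le h : (\esum_(x in setT) (hit h x)%:E <= h%:R%:E)%E.
Proof.
elim: h => [|h IH]; first by rewrite esum1 // => x _; rewrite hit0.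
apply: (@le_trans _ _ (\esum_(x in setT) (hit h x)%:E + 1)%E).
  apply: le_trans (mean_range_recursion h); rewrite leeDl // mule_ge0 //.
    by rewrite lee_fin ltW // (cw_gt0 cw).
  by apply: esum_ge0; nneg.
by rewrite -natr1 EFinD leeD2r.
Qed.

Definition mean_range (h : nat) : R := fine (\esum_(x in setT) (hit h x)%:E)%E.

Lemma mean_rangeE h : (\esum_(x in setT) (hit h x)%:E = (mean_range h)%:E)%E.
Proof.
rewrite /mean_range fineK // ge0_fin_numE; last by apply: esum_ge0; nneg.
exact: le_lt_trans (mean_range_le h) (ltry _).
Qed.

(** The mass cannot decrease, since [hit] is nondecreasing in h; hence branching
  never removes more than the unit that enters. *)
Lemma hit_square_sum_le h :
  (\esum_(x in setT) (hit h x ^+ 2)%:E <= (kappa^-1)%:E)%E.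
Proof.
have := mean_range_recursion h; rewrite !mean_rangeE.
have ML : mean_range h <= mean_range h.+1.
  by rewrite -lee_fin -!mean_rangeE; apply: le_esum => x _; rewrite lee_fin hit_leS.
have k0 := cw_gt0 cw.
have : (0 <= \esum_(x in setT) (hit h x ^+ 2)%:E)%E by apply: esum_ge0; nneg.
case: (\esum_(x in _) _)%E => [q| |] //; last first.
  by rewrite gt0_muley ?lte_fin // addey.
move=> _; rewrite -EFinM -!EFinD !lee_fin => H.
by rewrite -[leRHS]mul1r ler_pdivlMr // mulrC; lra.
Qed.

Definition square_sum (h : nat) : R :=
  fine (\esum_(x in setT) (hit h x ^+ 2)%:E)%E.

Lemma square_sumE h : (\esum_(x in setT) (hit h x ^+ 2)%:E = (square_sum h)%:E)%E.
Proof.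
rewrite /square_sum fineK // ge0_fin_numE; last by apply: esum_ge0; nneg.
exact: le_lt_trans (hit_square_sum_le h) (ltry _).
Qed.

Lemma square_sum_stabilizes (eta : R) : 0 < eta ->
  exists H, forall h, (H <= h)%N -> square_sum h <= square_sum H + eta.
Proof.
move=> eta0.
have ub h : square_sum h <= kappa^-1.
  by rewrite -lee_fin -square_sumE hit_square_sum_le.
have hs : has_sup (range square_sum).
  by split; [exists (square_sum 0), 0%N | exists kappa^-1 => _ [h _ <-]].
have [_ [H _ <-] HP] := sup_adherent eta0 hs.
exists H => h _; have : square_sum h <= sup (range square_sum).
  by apply: ub_le_sup; [case: hs | exists h].
lra.
Qed.

(** (u - v)^2 <= u^2 - v^2 when 0 <= v <= u. *)
Lemma hit_increment_square_sum (eta : R) H h : (H <= h)%N ->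
  square_sum h <= square_sum H + eta ->
  (\esum_(x in setT) ((hit h x - hit H x) ^+ 2)%:E <= eta%:E)%E.
Proof.
move=> Hh sq.
have : (\esum_(x in setT) ((hit h x - hit H x) ^+ 2)%:E + (square_sum H)%:E <=
        (square_sum h)%:E)%E.
  rewrite -!square_sumE -esumD; try by nneg.
  apply: le_esum => x _; rewrite -EFinD lee_fin.
  have := hit_ge0 H x; have := hit_le x Hh; nra.
have : (0 <= \esum_(x in setT) ((hit h x - hit H x) ^+ 2)%:E)%E.
  by apply: esum_ge0; nneg.
by case: (\esum_(x in _) _)%E => [q| |] // _; rewrite -EFinD !lee_fin; lra.
Qed.

(** N stands for the squared euclidean norm: [N_step] says that steps are
  centered with second moment s2, and [N_volume] that balls grow like in
  dimension four. *)
Section Displacement.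
Variables (N : V -> R) (s2 C : R).
Hypothesis N_ge0 : forall x, 0 <= N x.
Hypothesis N0 : N 0 = 0.
Hypothesis s2_ge0 : 0 <= s2.
Hypothesis C_ge0 : 0 <= C.
Hypothesis N_step : forall z,
  (\esum_(y in setT) (theta y * N (y + z)%R)%:E = (s2 + N z)%:E)%E.
Hypothesis N_volume : forall L : nat,
  (\esum_(x in setT) (N x < L%:R ^+ 2)%R%:R%:E <= (C * L%:R ^+ 4)%:E)%E.

(** Dropping the negative term of [rooted_hit_le] compares [hit] with the mean
  number of visits: one particle per generation, of second moment at most s2
  times the generation. *)
Lemma hit_second_moment h :
  (\esum_(x in setT) (hit h x * N x)%:E <= (s2 * h%:R ^+ 2)%:E)%E.
Proof.
elim: h => [|h IH]; first by rewrite esum1 ?lee_fin ?mulr_ge0 // => x _; rewrite hit0 mul0r.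
rewrite esum_hitS //.
apply: (@le_trans _ _ (\esum_(z in setT)
    ((hit h z * s2)%:E + (hit h z * N z)%:E + (s2 * (z == 0)%:R)%:E))%E).
  apply: le_esum => z _.
  rewrite (_ : \esum_(y in setT) _ = (rooted_hit h z * (s2 + N z))%:E)%E; last first.
    by rewrite EFinM -N_step -esum_scale //; nneg.
  rewrite -!EFinD lee_fin.
  have := ler_wpM2r (addr_ge0 s2_ge0 (N_ge0 z)) (rooted_hit_le_hit h z).
  have : (z == 0)%:R * (N z) = 0.
    by have [->|_] := eqVneq z 0; rewrite ?N0 ?mulr0 ?mul0r.
  by rewrite mulrDr !mulrDl; lra.
rewrite !esumD; try by nneg.
rewrite esum_delta0 //; under [X in (X + _ + _)%E]eq_esum => z _ do rewrite mulrC EFinM.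
rewrite esum_scale //; last by nneg.
apply: (@le_trans _ _ (s2%:E * h%:R%:E + (s2 * h%:R ^+ 2)%:E + s2%:E)%E).
  by rewrite !leeD // lee_wpmul2l ?lee_fin // mean_range_le.
rewrite -EFinM -!EFinD lee_fin -natr1.
have : 0 <= s2 * h%:R by rewrite mulr_ge0.
by nra.
Qed.

(** [hit h x] is at most [hit H x] plus the increment D of [hit] at x.  Inside
  the ball of radius L, D <= lam D^2 + 1 / (4 lam), a form of Cauchy-Schwarz;
  outside, [hit h x] <= [hit h x] N(x) / L^2. *)
Lemma mean_range_split (eta lam : R) H h (L : nat) : 0 < lam -> (0 < L)%N ->
  (H <= h)%N -> square_sum h <= square_sum H + eta ->
  mean_range h <= H%:R + lam * eta + C * L%:R ^+ 4 / (4 * lam) +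
                  s2 * h%:R ^+ 2 / L%:R ^+ 2.
Proof.
move=> lam0 L0 Hh sq; have LR : 0 < L%:R :> R by rewrite ltr0n.
have L2 : 0 < L%:R ^+ 2 :> R by rewrite exprn_gt0.
have lam4 : 0 <= (4 * lam)^-1 by rewrite invr_ge0; lra.
have L2' : 0 <= (L%:R ^+ 2)^-1 :> R by rewrite invr_ge0 ltW.
have lam0' := ltW lam0.
rewrite -lee_fin -mean_rangeE.
apply: (@le_trans _ _ (\esum_(x in setT) ((hit H x)%:E +
   lam%:E * ((hit h x - hit H x) ^+ 2)%:E +
   ((4 * lam)^-1)%:E * (N x < L%:R ^+ 2)%R%:R%:E +
   ((L%:R ^+ 2)^-1)%:E * (hit h x * N x)%:E))%E).
  apply: le_esum => x _; rewrite -!EFinM -!EFinD lee_fin.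
  have Hx := hit_ge0 H x; have hx := hit_ge0 h x; have Nx := N_ge0 x.
  have sq0 := sqr_ge0 (hit h x - hit H x).
  have [NL|NL] := ltP (N x) (L%:R ^+ 2).
    have : hit h x - hit H x <= lam * (hit h x - hit H x) ^+ 2 + (4 * lam)^-1.
      move: (hit h x - hit H x) => D; rewrite -subr_ge0.
      have -> : lam * D ^+ 2 + (4 * lam)^-1 - D = lam * (D - (2 * lam)^-1) ^+ 2.
        by field; rewrite gt_eqF.
      by rewrite mulr_ge0 ?sqr_ge0.
    have : 0 <= (L%:R ^+ 2)^-1 * (hit h x * N x) by rewrite !mulr_ge0.
    by rewrite mulr1; lra.
  rewrite mulr0 addr0.
  have : hit h x <= (L%:R ^+ 2)^-1 * (hit h x * N x).
    by rewrite mulrCA ler_peMr // mulrC ler_pdivlMr // mul1r.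
  have : 0 <= lam * (hit h x - hit H x) ^+ 2 by rewrite mulr_ge0.
  by lra.
rewrite !esumD; try by nneg.
rewrite !esum_scale //; try by nneg.
rewrite !EFinD !leeD //.
- exact: mean_range_le.
- by rewrite EFinM lee_wpmul2l ?lee_fin // hit_increment_square_sum.
- by rewrite (mulrC (C * _)) EFinM lee_wpmul2l ?lee_fin.
- by rewrite (mulrC (s2 * _)) EFinM lee_wpmul2l ?lee_fin // hit_second_moment.
Qed.

(** With h = j^2, L = K j and lam proportional to h, the last three terms of
  [mean_range_split] are all proportional to h: K makes the second-moment term
  small, then lam / h the volume term, then eta (hence H) the l2 term, and
  finally j absorbs H.  This balance is special to dimension four, where the
  volume L^4 is of order h^2. *)
Lemma mean_range_sublinear (eps : R) : 0 < eps ->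
  exists2 h, (0 < h)%N & mean_range h <= eps * h%:R.
Proof.
move=> e0.
pose K := (Num.trunc (4 * s2 / eps)).+1.
have K0 : 1 <= K%:R :> R by rewrite ler1n.
have KE : 4 * s2 / eps <= K%:R by exact/ltW/truncnS_gt.
pose lam := (C + 1) * K%:R ^+ 4 / eps.
have lam0 : 0 < lam.
  by rewrite divr_gt0 // mulr_gt0 ?exprn_gt0 // ltr_wpDl.
have lamE : lam * eps = (C + 1) * K%:R ^+ 4.
  by rewrite /lam divfK // gt_eqF.
clearbody lam; pose eta := eps / (4 * lam).
have eta0 : 0 < eta by rewrite divr_gt0 // mulr_gt0.
have [H HP] := square_sum_stabilizes eta0.
pose j := (Num.trunc (4 * H%:R / eps) + H).+1.
have j0 : 1 <= j%:R :> R by rewrite ler1n.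
have jH : (H <= j * j)%N by rewrite /j; lia.
have jE : 4 * H%:R / eps <= j%:R.
  apply: le_trans (ltW (truncnS_gt _)) _; rewrite ler_nat ltnS leq_addr //.
exists (j * j)%N => //.
have jj : (j * j)%:R = j%:R ^+ 2 :> R by rewrite natrM expr2.
have j2 : 0 < j%:R ^+ 2 :> R by rewrite exprn_gt0 //; lra.
have := @mean_range_split eta (lam * j%:R ^+ 2) H (j * j) (K * j) _ _ jH (HP _ jH).
rewrite mulr_gt0 // muln_gt0 /= => /(_ isT isT) /le_trans; apply.
rewrite jj natrM.
have t1 : H%:R <= eps / 4 * j%:R ^+ 2.
  have : 4 * H%:R <= j%:R * eps by rewrite -ler_pdivrMr.
  have : j%:R * eps <= j%:R ^+ 2 * eps by rewrite ler_wpM2r ?(ltW e0) // ler_eXnr.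
  lra.
have t2 : lam * j%:R ^+ 2 * eta = eps / 4 * j%:R ^+ 2.
  by rewrite /eta; field; rewrite ?gt_eqF.
have t3 : C * (K%:R * j%:R) ^+ 4 / (4 * (lam * j%:R ^+ 2)) <= eps / 4 * j%:R ^+ 2.
  rewrite ler_pdivrMr; last by rewrite !mulr_gt0.
  have -> : eps / 4 * j%:R ^+ 2 * (4 * (lam * j%:R ^+ 2)) =
      (C + 1) * (K%:R * j%:R) ^+ 4.
    transitivity (lam * eps * j%:R ^+ 4); first by field.
    by rewrite lamE; ring.
  by rewrite ler_wpM2r ?exprn_ge0 ?mulr_ge0 //; lra.
have t4 : s2 * (j%:R ^+ 2) ^+ 2 / (K%:R * j%:R) ^+ 2 <= eps / 4 * j%:R ^+ 2.
  rewrite ler_pdivrMr; last by rewrite exprn_gt0 // mulr_gt0 //; lra.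
  have -> : eps / 4 * j%:R ^+ 2 * (K%:R * j%:R) ^+ 2 =
    (eps / 4 * K%:R ^+ 2) * (j%:R ^+ 2) ^+ 2 by ring.
  rewrite ler_wpM2r ?sqr_ge0 //.
  have : 4 * s2 <= K%:R * eps by rewrite -ler_pdivrMr.
  have : K%:R * eps <= K%:R ^+ 2 * eps by rewrite ler_wpM2r ?(ltW e0) // ler_eXnr.
  lra.
lra.
Qed.

End Displacement.

(** A critical tree has one vertex per generation on average. *)
Lemma mean_size h :
  (\esum_(t in setT) (law t * (size (visits h t))%:R)%:E = h%:R%:E)%E.
Proof.
elim: h => [|h IH]; first by rewrite esum1 // => t _; rewrite visits0 mulr0.
have b0 (t : mtree V) : 0 <= (size (visits h t))%:R :> R by [].
have := esum_mlaw_sum theta_ge0 theta_mass cw b0 IH.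
rewrite addrC natr1 => <-; apply: eq_esum => t _.
by rewrite size_visitsS natrD natr_sum.
Qed.

Lemma esum_mem_undup (s : seq V) :
  (\esum_(x in setT) (x \in s)%:R%:E = (size (undup s))%:R%:E :> \bar R)%E.
Proof.
elim: s => [|x s IH]; first by rewrite esum1.
rewrite /=; case: ifPn => xs.
  rewrite -IH; apply: eq_esum => y _; rewrite inE.
  by have [->|] := eqVneq y x; rewrite ?xs.
rewrite /= -natr1 addrC EFinD -IH.
have {1}-> : (1 = \esum_(y in setT) (y == x)%:R%:E :> \bar R)%E.
  by rewrite (esum_single (z := x)) ?eqxx ?lee_fin // => y /negPf ->.
rewrite -esumD; try by nneg.
apply: eq_esum => y _; rewrite -EFinD -natrD inE; congr (_%:R)%:E.
by have [->|] := eqVneq y x; rewrite ?(negPf xs).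
Qed.

Lemma mean_waste h :
  (\esum_(t in setT) (law t * (waste (visits h t))%:R)%:E =
   (h%:R - mean_range h)%:E)%E.
Proof.
have range_eq : (\esum_(t in setT) (law t * (size (undup (visits h t)))%:R)%:E =
    (mean_range h)%:E)%E.
  rewrite -mean_rangeE; under [RHS]eq_esum => x _ do rewrite -hitE.
  rewrite esum_exchange; last by nneg.
  apply: eq_esum => t _; rewrite EFinM -esum_mem_undup -esum_scale //; nneg.
have : (\esum_(t in setT) (law t * (waste (visits h t))%:R)%:E +
        (mean_range h)%:E = h%:R%:E)%E.
  rewrite -range_eq -(mean_size h) -esumD; try by nneg.
  apply: eq_esum => t _; rewrite -EFinD -mulrDr -natrD subnK //.
  exact: size_undup.
case: (\esum_(t in _) _)%E => [q| |] // [<-]; congr EFin; ring.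
Qed.

End ExpectedRange.


(** * Centered steps in dimension four *)

Lemma countable_Z4 : countable [set: Z4].
Proof. exact: (@countableP 'rV[int]_4). Qed.

Lemma measurable_Z4 (A : set Z4) : measurable A.
Proof. by []. Qed.

Lemma measurable_fun_Z4 d (T : sigmaRingType d) (f : Z4 -> T) :
  measurable_fun setT f.
Proof. by move=> _ Y _; exact: measurable_Z4. Qed.

Section Steps.
Variables (R : realType) (theta : probability Z4 R).
Let p x := fine (theta [set x]).

Definition sqnorm (x : Z4) : R := \sum_(i < 4) z4coord R i x ^+ 2.

Lemma sqnorm_ge0 x : 0 <= sqnorm x.
Proof. by rewrite sumr_ge0 // => i _; rewrite sqr_ge0. Qed.

Lemma sqnorm0 : sqnorm 0 = 0.
Proof. by rewrite /sqnorm big1 // => i _; rewrite /z4coord mxE expr0n. Qed.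

Lemma z4coordD i x y : z4coord R i (x + y) = z4coord R i x + z4coord R i y.
Proof. by rewrite /z4coord mxE rmorphD. Qed.

Lemma coord_sq_le i x : z4coord R i x ^+ 2 <= sqnorm x.
Proof.
by rewrite /sqnorm (bigD1 i) //= lerDl sumr_ge0 // => j _; rewrite sqr_ge0.
Qed.

Lemma sqnorm_le_moment (delta : R) x : 2 <= delta ->
  sqnorm x <= 1 + enorm R x `^ delta.
Proof.
move=> d2; have -> : sqnorm x = enorm R x ^+ 2 by rewrite sqr_sqrtr // sqnorm_ge0.
have e0 : 0 <= enorm R x by exact: sqrtr_ge0.
have [e1|/ltW e1] := leP (enorm R x) 1.
  by rewrite ler_wpDr ?powR_ge0 // exprn_ile1.
by rewrite ler_wpDl // -powR_mulrn // ler_powR.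
Qed.

(** The moment of order delta >= 2 dominates every function of quadratic
  growth. *)
Lemma integrable_le_sqnorm (f : Z4 -> R) (delta : R) : 2 <= delta ->
  finite_moment theta delta -> (forall x, `|f x| <= 1 + sqnorm x) ->
  theta.-integrable setT (EFin \o f).
Proof.
move=> d2 mom fle; apply/integrableP; split; first exact: measurable_fun_Z4.
apply: (@le_lt_trans _ _
    (\int[theta]_x ((2 : R)%:E + (enorm R x `^ delta)%:E))%E).
  apply: ge0_le_integral => //; try exact: measurable_fun_Z4.
  move=> x _ /=; rewrite -EFinD lee_fin (le_trans (fle x)) //.
  by have := sqnorm_le_moment x d2; lra.
rewrite ge0_integralD //; last by move=> x _; rewrite lee_fin powR_ge0.
rewrite integral_cst // [X in (_ * X)%E]probability_setT mule1 lte_add_pinfty ?ltry //.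
by move: mom; rewrite /finite_moment unlock.
Qed.

Lemma coord_second_moment (delta : R) i (c : R) : 2 <= delta ->
  centered theta -> finite_moment theta delta ->
  (\esum_(y in setT) (p y * (z4coord R i y + c) ^+ 2)%:E =
   \esum_(y in setT) (p y * z4coord R i y ^+ 2)%:E + (c ^+ 2)%:E)%E.
Proof.
move=> d2 cent mom.
have conv (f : Z4 -> R) : (forall x, 0 <= f x) ->
    (\esum_(y in setT) (p y * f y)%:E = \int[theta]_y (f y)%:E)%E.
  move=> f0; rewrite integral_discrete //; last exact: countable_Z4.
  by apply: eq_esum => y _; rewrite mulrC.
rewrite !conv; try by move=> x; exact: sqr_ge0.
have i1 : theta.-integrable setT (EFin \o z4coord R i).
  apply: (integrable_le_sqnorm d2 mom) => x; have := coord_sq_le i x.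
  by rewrite -real_normK ?num_real //; move: (`|_|) => a; nra.
have i2 : theta.-integrable setT (EFin \o (fun y => z4coord R i y ^+ 2)).
  apply: (integrable_le_sqnorm d2 mom) => x; have := coord_sq_le i x.
  by rewrite ger0_norm ?sqr_ge0 //; lra.
have i0 (a : R) : theta.-integrable setT (EFin \o cst a).
  exact: finite_measure_integrable_cst.
have i1c : theta.-integrable setT (EFin \o (fun y => 2 * c * z4coord R i y)).
  by have := integrableZl measurableT (2 * c) i1.
have i1d : theta.-integrable setT (EFin \o (fun y => 2 * c * z4coord R i y + c ^+ 2)).
  by have := integrableD measurableT i1c (i0 (c ^+ 2)).
transitivity (\int[theta]_y ((z4coord R i y ^+ 2)%:E +
    (2 * c * z4coord R i y + c ^+ 2)%:E))%E.
  by apply: eq_integral => y _; rewrite -EFinD; congr EFin; ring.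
rewrite integralD //; congr (_ + _)%E.
transitivity (\int[theta]_y ((2 * c * z4coord R i y)%:E + (c ^+ 2)%:E))%E.
  by apply: eq_integral => y _; rewrite -EFinD.
rewrite integralD //; last exact: i0.
rewrite integral_cst // [X in (_ * X)%E]probability_setT mule1.
rewrite (_ : \int[theta]_x (2 * c * z4coord R i x)%:E = 0)%E ?add0e //.
under eq_integral => y _ do rewrite EFinM.
rewrite integralZl //; have := cent i; rewrite unlock => ->.
by rewrite mule0.
Qed.

Lemma sqnorm_second_moment (delta : R) : 2 <= delta ->
  centered theta -> finite_moment theta delta ->
  exists2 s2 : R, 0 <= s2 & forall z,
    (\esum_(y in setT) (p y * sqnorm (y + z)%R)%:E = (s2 + sqnorm z)%:E)%E.
Proof.
move=> d2 cent mom.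
have p0 x : 0 <= p x by rewrite fine_ge0.
have S0 : (0 <= \esum_(y in setT) (p y * sqnorm y)%:E)%E.
  by apply: esum_ge0 => x _; rewrite lee_fin mulr_ge0 // sqnorm_ge0.
have Sfin : (\esum_(y in setT) (p y * sqnorm y)%:E < +oo)%E.
  have sq1 x : `|sqnorm x| <= 1 + sqnorm x.
    by rewrite ger0_norm ?sqnorm_ge0 //; lra.
  have /integrableP[_] := integrable_le_sqnorm d2 mom sq1.
  rewrite (_ : \int[theta]_x _ = \int[theta]_x (sqnorm x)%:E)%E; last first.
    by apply: eq_integral => x _; rewrite gee0_abs // lee_fin sqnorm_ge0.
  rewrite integral_discrete //; last exact: sqnorm_ge0.
    by under eq_esum => x _ do rewrite mulrC.
  exact: countable_Z4.
exists (fine (\esum_(y in setT) (p y * sqnorm y)%:E)) => [|z]; first exact: fine_ge0.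
rewrite EFinD fineK ?ge0_fin_numE //.
have expand x : p x * sqnorm x = \sum_(i < 4) p x * z4coord R i x ^+ 2.
  by rewrite mulr_sumr.
transitivity (\sum_(i < 4) \esum_(y in setT)
    (p y * (z4coord R i y + z4coord R i z) ^+ 2)%:E)%E.
  rewrite -esum_sum; last by move=> x i _ _; rewrite lee_fin mulr_ge0 ?sqr_ge0.
  apply: eq_esum => y _; rewrite sumEFin -mulr_sumr; congr (_ * _)%:E.
  by apply: eq_bigr => i _; rewrite z4coordD.
under eq_bigr => i _ do rewrite (coord_second_moment i _ d2 cent mom).
rewrite big_split /= sumEFin; congr (_ + _)%E.
rewrite -esum_sum; last by move=> x i _ _; rewrite lee_fin mulr_ge0 ?sqr_ge0.
by apply: eq_esum => y _; rewrite sumEFin -expand.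
Qed.

(** The ball of radius L lies in the box of points with coordinates less than L
  in absolute value, hence in a box of (2 L + 1)^4 <= (3 L)^4 = 81 L^4
  points. *)
Lemma sqnorm_volume (L : nat) :
  (\esum_(x in setT) (sqnorm x < L%:R ^+ 2)%R%:R%:E <= (81 * L%:R ^+ 4)%:E :> \bar R)%E.
Proof.
case: L => [|L].
  rewrite esum1 ?lee_fin ?mulr_ge0 // => x _.
  by rewrite expr0n /= ltNge sqnorm_ge0.
set K := L.+1; pose box := {ffun 'I_4 -> 'I_(2 * K).+1}.
pose e (u : box) : Z4 := \row_i ((u i)%:Z - K%:Z).
apply: (@le_trans _ _ (\esum_(x in setT) \sum_(u : box) ((x == e u)%:R : R)%:E)%E).
  apply: le_esum => x _; rewrite sumEFin lee_fin.
  have [xL|_] := ltP (sqnorm x) (K%:R ^+ 2); last by rewrite sumr_ge0.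
  have xK i : (`|x ord0 i| < K)%N.
    have := le_lt_trans (coord_sq_le i x) xL.
    rewrite /z4coord -[X in X < _]real_normK ?num_real // ltr_sqr ?nnegrE //.
    by rewrite -intr_norm -[K%:R]/(K%:Z%:~R) ltr_int -abszE.
  pose u : box := [ffun i => inord (absz (x ord0 i + K%:Z)%R)].
  rewrite (bigD1 u) //= (_ : x == e u) ?lerDl ?sumr_ge0 //.
  apply/eqP/rowP => i; rewrite mxE ffunE -[x 0 i]/(x ord0 i).
  by rewrite inordK; have := xK i; move: (x ord0 i) (K) => z k; lia.
rewrite esum_sum; last by move=> x u _ _; rewrite lee_fin.
under eq_bigr => u _.
  rewrite (esum_single (z := e u)) ?eqxx ?lee_fin //; last by move=> x /negPf ->.
  over.
rewrite sumEFin lee_fin sumr_const card_ffun !card_ord -[_ *+ _]/(_%:R).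
rewrite -[81]/(81%:R) -natrX -natrM ler_nat.
by rewrite -[81%N]/((3 ^ 4)%N) -expnMn leq_exp2r //; lia.
Qed.

End Steps.


(** * The walk on the conditioned tree as a marked tree *)

Fixpoint labels (X : Type) (x0 : X) (l : mtree X) (u : seq nat) : X :=
  match u with
  | [::] => mark l
  | i :: u' => labels x0 (nth (MNode x0 [::]) (kids l) i) u'
  end.

(** [labels] reads back the marks, with x0 as a default outside the tree, so
  that every marked tree is a decorated plane tree. *)
Lemma decorate_labels (X : eqType) (x0 : X) (l : mtree X) :
  decorate (unmark l) (labels x0 l) = l.
Proof.
elim/mtree_ind_kids: l => y s IH; rewrite [unmark _]/= decorateE; congr MNode.
rewrite -[RHS](mkseq_nth (MNode x0 [::])) size_map.
apply/eq_in_map => i; rewrite mem_iota /= => il.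
by rewrite (nth_map (MNode x0 [::])) // -[RHS]IH // mem_nth.
Qed.

Lemma labels_decorate (X : Type) (x0 : X) t (x : seq nat -> X) u :
  u \in vertices t -> labels x0 (decorate t x) u = x u.
Proof.
elim/tree_ind_subtrees: t x u => s IH x [|i u]; rewrite decorateE //.
rewrite verticesE inE /= => /flattenP[_ /mapP[j + ->] /mapP[v vj [-> ->]]].
rewrite mem_iota /= => js.
by rewrite nth_mkseq // IH // mem_nth.
Qed.

Lemma eq_decorate (X : Type) t (x x' : seq nat -> X) :
  (forall u, u \in vertices t -> x u = x' u) -> decorate t x = decorate t x'.
Proof.
elim/tree_ind_subtrees: t x x' => s IH x x' xx; rewrite !decorateE.
rewrite xx; last by rewrite verticesE mem_head.
congr MNode; apply/eq_in_map => i; rewrite mem_iota /= => il.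
apply: IH; rewrite ?mem_nth // => u uv; apply: xx.
rewrite verticesE inE; apply/orP; right; apply/flattenP.
exists (map (cons i) (vertices (nth (Node [::]) s i))); last exact: map_f.
by apply/mapP; exists i => //; rewrite mem_iota.
Qed.

Lemma prod_vertices_root (R : realType) t (f : seq nat -> R) :
  \prod_(u <- vertices t) f u = f [::] * \prod_(u <- vertices t | u != [::]) f u.
Proof.
case: t => s; rewrite verticesE !big_cons /=; congr (_ * _).
rewrite [RHS]big_mkcond /=; rewrite big_seq [RHS]big_seq.
by apply: eq_bigr => u /flattenP[_ /mapP[i _ ->] /mapP[v _ ->]].
Qed.

Section Transfer.
Variables (R : realType) (mu : probability nat R) (theta : probability Z4 R).
Let p x := fine (theta [set x]).
Let m k := fine (mu [set k]).
Variable kappa : R.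
Hypothesis cw : critical_weights m kappa.
Let law := mlaw p m.
Let p_ge0 x : 0 <= p x. Proof. exact: fine_ge0. Qed.
Let law_ge0 t : 0 <= law t. Proof. exact: (mlaw_ge0 p_ge0 cw). Qed.
Hint Resolve law_ge0 : core.

Variables (n : nat) (d : measure_display) (Omega : measurableType d).
Variables (P : probability Omega R) (T : Omega -> tree).
Variable W : Omega -> seq nat -> Z4.
Hypothesis walk : is_walk mu theta n P T W.
Hypothesis size_gt0 : 0 < bienayme_size_law mu n.+1.

Definition increment (w : Omega) (u : seq nat) : Z4 :=
  if u == [::] then 0 else W w u - W w (parent u).

Definition walk_tree (w : Omega) : mtree Z4 := decorate (T w) (increment w).

Lemma map_walk_tree w : map (W w) (vertices (T w)) = positions (walk_tree w).
Proof.
rewrite (@map_walk_vertices _ _ (increment w) (W w) 0).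
- by under eq_map => x do rewrite add0r; rewrite map_id.
- by rewrite addr0 walk.1.
- by move=> u _ /negPf u0; rewrite /increment u0.
Qed.

Lemma walk_treeE l : mark l = 0 ->
  [set w | walk_tree w = l] = [set w | T w = unmark l /\
    forall u, u \in vertices (unmark l) -> u != [::] ->
              W w u - W w (parent u) = labels 0 l u].
Proof.
move=> l0; apply/seteqP; split=> w /= => [wl|[TE WE]].
  have TE : T w = unmark l by rewrite -wl unmark_decorate.
  split=> // u uv u0; rewrite -wl labels_decorate ?TE //.
  by rewrite /increment (negPf u0).
rewrite -(decorate_labels 0 l) /walk_tree TE; apply: eq_decorate => u uv.
rewrite /increment; case: eqVneq => [->|u0] /=; first by rewrite l0.
exact: WE.
Qed.

Lemma mark_walk_tree w : mark (walk_tree w) = 0.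
Proof. by rewrite /walk_tree; case: (T w) => s; rewrite decorateE. Qed.

Lemma measurable_walk_tree l : measurable [set w | walk_tree w = l].
Proof.
have [l0|l0] := eqVneq (mark l) 0.
  by rewrite walk_treeE //; have [] := walk.2 (unmark l) (labels 0 l).
rewrite (_ : [set w | _] = set0) //; apply/seteqP; split=> // w /= wl.
by move: l0; rewrite -wl mark_walk_tree eqxx.
Qed.

(** The mark of the root is 0 for the walk and has law theta in [law], whence the
  change of root and the factor p y. *)
Lemma walk_tree_law y s : msize (MNode y s) = n.+1 ->
  p y * (bienayme_size_law mu n.+1 *
         fine (P [set w | walk_tree w = MNode 0 s])) = law (MNode y s).
Proof.
move=> sn; pose ly := MNode y s.
have -> : [set w | walk_tree w = MNode 0 s] = [set w | T w = unmark ly /\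
    forall u, u \in vertices (unmark ly) -> u != [::] ->
              W w u - W w (parent u) = labels 0 ly u].
  rewrite walk_treeE //; apply/seteqP.
  by split=> w [TE WE]; split=> // u uv u0; rewrite WE //; case: u {uv} u0.
have [_ ->] := walk.2 (unmark ly) (labels 0 ly).
have -> : law ly = bienayme_law mu (unmark ly) *
    (p y * \prod_(u <- vertices (unmark ly) | u != [::]) p (labels 0 ly u)).
  by rewrite -{1}(decorate_labels 0 ly) /law mlaw_decorate prod_vertices_root.
have sz : size (vertices (unmark ly)) = n.+1.
  by rewrite -(msize_decorate _ (labels 0 ly)) decorate_labels.
rewrite /conditioned_law sz eqxx.
move: (bienayme_law _ _) (\prod_(_ <- _ | _) _) => a b /=.
by field; rewrite gt_eqF.
Qed.

Lemma walk_tree_law0 s : msize (MNode 0 s) <> n.+1 ->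
  P [set w | walk_tree w = MNode 0 s] = 0%E.
Proof.
move=> sn; rewrite walk_treeE //.
have [_ ->] := walk.2 (unmark (MNode 0 s)) (labels 0 (MNode 0 s)).
rewrite /conditioned_law ifF ?mul0r //; apply/eqP.
by rewrite -(msize_decorate _ (labels 0 (MNode 0 s))) decorate_labels.
Qed.

(** For events that do not depend on the mark of the root, this mark may as well
  be drawn from theta; the walk on T is then a marked Bienayme tree conditioned
  on its size. *)
Lemma walk_tree_prob (B : set (mtree Z4)) :
  (forall y s, B (MNode y s) <-> B (MNode 0 s)) ->
  ((bienayme_size_law mu n.+1)%:E * P [set w | B (walk_tree w)] =
   \esum_(l in [set l | msize l = n.+1 /\ B l]) (law l)%:E)%E.
Proof.
move=> B0; have sl0 := ltW size_gt0.
have cT : countable [set: mtree Z4] by exact: (@countableP (mtree 'rV[int]_4)).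
set A := [set w | B (walk_tree w)].
have AE : A = \bigcup_(l in B) [set w | walk_tree w = l].
  apply/seteqP; split=> [w Bw|w [l Bl /= wl]]; first by exists (walk_tree w).
  by rewrite /A /= wl.
have PA : (P A = \esum_(s in setT)
    if MNode 0%R s \in B then P [set w | walk_tree w = MNode 0%R s] else 0)%E.
  rewrite AE measure_countable_bigcup //; first last.
  - by move=> l l' _ _ [w [/= <- <-]].
  - exact: measurable_walk_tree.
  rewrite esum_mkcond esum_mtree; last by move=> l; case: ifP.
  rewrite (esum_single (z := 0 : Z4)) //; first last.
  - by apply: esum_ge0 => s _; case: ifP.
  - move=> y y0; rewrite esum1 // => s _; case: ifP => // _.
    rewrite (_ : [set w | _] = set0) //; apply/seteqP; split=> // w /= wl.
    by move: y0; rewrite -[y]/(mark (MNode y s)) -wl mark_walk_tree eqxx.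
have mA : measurable A.
  rewrite AE bigcup_mkcond; apply: countable_bigcupT_measurable => // l.
  by case: ifP => // _; exact: measurable_walk_tree.
have c0 : 0 <= fine (P A) by rewrite fine_ge0.
have PAE : P A = (fine (P A))%:E by rewrite fineK // fin_num_measure.
rewrite esum_mkcond esum_mtree; last by move=> l; case: ifP => // _; rewrite lee_fin.
transitivity (\esum_(y in setT)
    ((bienayme_size_law mu n.+1 * fine (P A))%:E * (p y)%:E))%E.
  rewrite esum_scale ?mulr_ge0 //; last by move=> y _; rewrite lee_fin.
  rewrite (discrete_mass theta countable_Z4 measurable_Z4) mule1 EFinM.
  by rewrite -PAE.
apply: eq_esum => y _; rewrite muleC EFinM -PAE PA.
rewrite muleA -EFinM -esum_scale ?mulr_ge0 //; last by move=> s _; case: ifP.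
apply: eq_esum => s _.
have [sn|sn] := eqVneq (msize (MNode (0 : Z4) s)) n.+1; last first.
  rewrite [RHS]ifF; last by apply/negP => /set_mem[sn' _]; move: sn; rewrite -sn' eqxx.
  by case: ifP => _; rewrite ?walk_tree_law0 ?mule0 //; apply/eqP.
have [Bs|Bs] := boolP (MNode 0 s \in B).
  rewrite [RHS]ifT; last by apply/mem_set; split => //; apply/B0/set_mem.
  rewrite -(walk_tree_law (y := y)) // mulrA [RHS]EFinM; congr (_ * _)%E.
  by rewrite fineK // fin_num_measure //; exact: measurable_walk_tree.
rewrite mule0 [RHS]ifF //; apply/negP => /set_mem[_ /B0 Bs'].
by move: Bs; rewrite mem_set.
Qed.

End Transfer.

Section UnionBound.
Variables (R : realType) (X : choiceType) (theta : X -> R) (m : nat -> R).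
Variable kappa : R.
Hypothesis theta_ge0 : forall x, 0 <= theta x.
Hypothesis theta_mass : (\esum_(x in setT) (theta x)%:E = 1)%E.
Hypothesis cw : critical_weights m kappa.
Let law := mlaw theta m.

Definition deficient (eps : R) (c : mtree X) (t : mtree X) : Prop :=
  (count_mem c (fringe t))%:R < (1 - eps) * law c * (msize t)%:R.

(** Union bound; the largest of the finitely many rates is still less than 1. *)
Lemma deficient_bound (eps : R) (S : seq (mtree X)) : 0 < eps < 1 ->
  exists2 rho : R, 0 < rho < 1 & forall N,
    (\esum_(t in [set t | msize t = N /\
        exists2 c, c \in S & deficient eps c t]) (law t)%:E <=
     ((size S)%:R * rho ^+ N)%:E)%E.
Proof.
move=> e01; have law0 t : 0 <= law t by exact: (mlaw_ge0 theta_ge0 cw).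
elim: S => [|c S [r1 /andP[r10 r11] IH]].
  exists 2^-1 => [|N]; first by lra.
  by rewrite (_ : [set t | _] = set0) ?esum_set0 ?mul0r //; apply/seteqP; split=> // t [_ []].
have [r2 /andP[r20 r21] cP] := fringe_concentration theta_ge0 theta_mass cw c e01.
exists (Num.max r1 r2) => [|N]; first by rewrite lt_max r10 gt_max r11 r21.
set r := Num.max r1 r2.
have rr1 : r1 ^+ N <= r ^+ N by rewrite lerXn2r ?nnegrE ?le_max ?lexx ?(ltW r10).
have rr2 : r2 ^+ N <= r ^+ N.
  by rewrite lerXn2r ?nnegrE ?le_max ?lexx ?(ltW r10) ?(ltW r20) ?orbT.
rewrite [size _]/= -natr1 mulrDl mul1r EFinD.
have le1 := le_trans (cP N) (_ : (r2 ^+ N)%:E <= (r ^+ N)%:E)%E.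
have le2 := le_trans (IH N) (_ : ((size S)%:R * r1 ^+ N)%:E <=
   ((size S)%:R * r ^+ N)%:E)%E.
apply: le_trans (leeD (le2 _) (le1 _)); rewrite ?lee_fin ?ler_wpM2l //.
rewrite esum_mkcond [X in (_ <= X + _)%E]esum_mkcond.
rewrite [X in (_ <= _ + X)%E]esum_mkcond -esumD; last 2 first.
- by move=> t _; case: ifP => // _; rewrite lee_fin.
- by move=> t _; case: ifP => // _; rewrite lee_fin.
apply: le_esum => t _; case: ifPn => [/set_mem[tN [c']]|_]; last first.
  by rewrite adde_ge0 //; case: ifP => // _; rewrite lee_fin.
rewrite inE => /predU1P[->|c'S] dt.
  rewrite [X in (_ <= _ + X)%E]ifT ?leeDr //.
    by case: ifP => // _; rewrite lee_fin.
  by apply/mem_set; split; rewrite // -tN.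
rewrite [X in (_ <= X + _)%E]ifT ?leeDl //.
  by case: ifP => // _; rewrite lee_fin.
by apply/mem_set; split => //; exists c'.
Qed.

End UnionBound.


(** * Conclusion *)

Section FewPositions.
Variables (R : realType) (V : zmodType) (theta : V -> R) (m : nat -> R).
Let law := mlaw theta m.

(** The patterns in S carry almost all of the mean waste h.  If each of them
  occurs almost as often as expected, [sum_waste_fringe] shows that almost all
  vertices are wasted. *)
Lemma few_positions (eps : R) h (S : seq (mtree V)) t :
  0 < eps < 1 -> (0 < h)%N -> uniq S ->
  h%:R * (1 - 2 * eps) <= \sum_(c <- S) law c * (waste (visits h c))%:R ->
  (forall c, c \in S -> ~ deficient theta m eps c t) ->
  (size (undup (positions t)))%:R <= 3 * eps * (msize t)%:R.
Proof.
move=> /andP[e0 e1] h0 uS SE nd; have hR : 0 < h%:R :> R by rewrite ltr0n.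
have t0 : 0 <= (msize t)%:R :> R by [].
have w1 : (\sum_(c <- S) (count_mem c (fringe t) * waste (visits h c))%N%:R : R) <=
    h%:R * (waste (positions t))%:R.
  rewrite -natr_sum -natrM ler_nat; apply: leq_trans (sum_waste_fringe h t).
  exact: sum_count_le.
have w2 : (1 - eps) * (msize t)%:R * (h%:R * (1 - 2 * eps)) <=
    \sum_(c <- S) (count_mem c (fringe t) * waste (visits h c))%N%:R.
  apply: (@le_trans _ _ ((1 - eps) * (msize t)%:R *
     \sum_(c <- S) law c * (waste (visits h c))%:R)).
    by rewrite ler_wpM2l // mulr_ge0 //; lra.
  rewrite mulr_sumr big_seq [leRHS]big_seq ler_sum // => c cS.
  rewrite natrM mulrA ler_wpM2r //.
  have := nd c cS; rewrite /deficient => /negP; rewrite -leNgt.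
  by rewrite mulrAC.
have -> : (size (undup (positions t)))%:R =
    (msize t)%:R - (waste (positions t))%:R :> R.
  rewrite /waste natrB ?size_undup // size_positions; ring.
suff : (1 - 3 * eps) * (msize t)%:R <= (waste (positions t))%:R by lra.
rewrite -(ler_pM2l hR); apply: le_trans (le_trans w2 w1).
have -> : (1 - eps) * (msize t)%:R * (h%:R * (1 - 2 * eps)) =
  h%:R * ((1 - eps) * (1 - 2 * eps) * (msize t)%:R) by ring.
by rewrite ler_pM2l // ler_wpM2r //; nra.
Qed.

(** Finitely many patterns suffice because a sum of nonnegative terms is the
  supremum of its finite partial sums. *)
Lemma wasteful_patterns (a : R) h :
  (forall t, 0 <= law t) ->
  (a%:E < \esum_(t in setT) (law t * (waste (visits h t))%:R)%:E)%E ->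
  exists2 S : seq (mtree V), uniq S &
    a <= \sum_(c <- S) law c * (waste (visits h c))%:R.
Proof.
move=> law0 /ereal_sup_gt[_ [A [fA _] <-]].
rewrite fsbig_finite // sumEFin lte_fin => aA.
by exists (fset_set A); [exact: fset_uniq | exact: ltW].
Qed.

End FewPositions.

Theorem proposition1p6 (R : realType)
    (mu : probability nat R) (theta : probability Z4 R) (delta : R)
    (mu_critical : critical mu) (mu_dom2 : dom2 mu)
    (theta_centered : centered theta)
    (theta_cov : cov_matrix theta \in unitmx)
    (delta_gt4 : 4 < delta) (theta_moment : finite_moment theta delta)
    (d : nat -> measure_display)
    (Omega : forall n : nat, measurableType (d n))
    (P : forall n : nat, probability (Omega n) R)
    (T : forall n : nat, Omega n -> tree)
    (W : forall n : nat, Omega n -> seq nat -> Z4)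
    (walk : forall n : nat, 0 < bienayme_size_law mu n.+1 ->
              is_walk mu theta n (P n) (@T n) (@W n))
    (eps : R) (eps_gt0 : 0 < eps) :
  P n [set w | eps < (range_size (T n w) (W n w))%:R / n%:R]
    @[n --> within [set n | 0 < bienayme_size_law mu n.+1] \oo] --> 0%E.
Proof.
have [kappa cw] := critical_offspring mu_critical.
pose p (x : Z4) : R := fine (theta [set x]).
pose m k : R := fine (mu [set k]).
have p_ge0 x : 0 <= p x by exact: fine_ge0.
have p_mass := discrete_mass theta countable_Z4 measurable_Z4.
have law_ge0 t : 0 <= mlaw p m t by exact: (mlaw_ge0 p_ge0 cw).
have delta_ge2 : 2 <= delta by lra.
have [s2 s2_ge0 step] := sqnorm_second_moment delta_ge2 theta_centered theta_moment.
(* Outside the deficient trees the range is at most 3 e (n + 1) <= 6 e n, which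
   has to be less than eps n. *)
pose e : R := Num.min eps 1 / 7.
have e01 : 0 < e < 1.
  rewrite divr_gt0 ?lt_min ?eps_gt0 //= ltr_pdivrMr // mul1r.
  by rewrite gt_min (_ : 1 < 7) ?orbT //; lra.
have /andP[e0 e1] := e01.
have e7 : 7 * e <= eps by rewrite /e mulrC divfK // ge_min lexx.
have [h h0 rangeE] := @mean_range_sublinear R Z4 p m kappa p_ge0 p_mass cw
  (@sqnorm R) s2 81 (@sqnorm_ge0 R) (@sqnorm0 R) s2_ge0 (ler0n _ _) step
  (@sqnorm_volume R) e e0.
have hR : 0 < h%:R :> R by rewrite ltr0n.
have [S uS SE] : exists2 S : seq (mtree Z4), uniq S &
    h%:R * (1 - 2 * e) <= \sum_(c <- S) mlaw p m c * (waste (visits h c))%:R.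
  apply: wasteful_patterns => //.
  rewrite (mean_waste p_ge0 p_mass cw) lte_fin.
  have : 0 < h%:R * e by rewrite mulr_gt0.
  by lra.
have [rho /andP[rho0 rho1] bound] := deficient_bound p_ge0 p_mass cw S e01.
(* Any rate strictly between rho and 1 for the size law leaves the ratio q < 1. *)
pose rho' := (1 + rho) / 2.
have rho'01 : 0 < rho' < 1 by rewrite /rho'; lra.
have /andP[rho'0 rho'1] := rho'01.
have [c c0 lower] := size_law_subexponential cw rho'01.
pose q := rho / rho'.
have q01 : 0 <= q < 1.
  by rewrite divr_ge0 ?(ltW rho0) ?(ltW rho'0) //= ltr_pdivrMr // /rho'; lra.
pose K := (size S)%:R / c.
apply: (@squeeze_cvge _ _ _ _ (cst 0%E) _ (fun n => (K * q ^+ n)%:E)).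
- near=> n; rewrite measure_ge0 /=.
  have n0 : (0 < n)%N by near: n; apply: cvg_within; exact: nbhs_infty_gt.
  have sl0 : 0 < bienayme_size_law mu n.+1 by near: n; exact: withinT.
  pose B : set (mtree Z4) :=
    [set l | eps < (size (undup (positions l)))%:R / n%:R].
  have -> : [set w | eps < (range_size (T n w) (W n w))%:R / n%:R] =
      [set w | B (walk_tree (@T n) (@W n) w)].
    apply/seteqP; split=> w; rewrite /B /= /range_size.
      by rewrite (map_walk_tree (walk n sl0)).
    by rewrite (map_walk_tree (walk n sl0)).
  have B0 y s : B (MNode y s) <-> B (MNode 0 s).
    by rewrite /B /= size_undup_positions.
  have := walk_tree_prob cw (walk n sl0) sl0 B0.
  set PB := P n _ => PBE.
  have PBle : ((bienayme_size_law mu n.+1)%:E * PB <=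
      ((size S)%:R * rho ^+ n.+1)%:E)%E.
    rewrite PBE; apply: le_trans (bound n.+1).
    apply: esum_subset => [l [ln Bl]|l _]; last by rewrite lee_fin; exact: law_ge0.
    split=> //; apply: contrapT => no.
    have := few_positions e01 h0 uS SE (t := l) (fun c cS dl => no (ex_intro2 _ _ c cS dl)).
    rewrite ln => le3; move: Bl; rewrite /B /= ltr_pdivlMr ?ltr0n // => gt_eps.
    have nR : 1 <= n%:R :> R by rewrite ler1n.
    have : 7 * e * n%:R <= eps * n%:R by rewrite ler_wpM2r.
    have : 3 * e * n.+1%:R <= 6 * e * n%:R by rewrite -natr1; nra.
    have : 0 < e * n%:R by rewrite mulr_gt0 //; lra.
    lra.
  have : (0 <= PB)%E by exact: measure_ge0.
  move: PBle; case: PB {PBE} => [r| |] //; last first.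
    by rewrite gt0_muley ?lte_fin.
  rewrite -EFinM !lee_fin => le1 r0.
  rewrite /K /q expr_div_n mulrA ler_pdivlMr ?exprn_gt0 //.
  rewrite mulrAC ler_pdivlMr //.
  apply: (@le_trans _ _ ((size S)%:R * rho ^+ n.+1)); last first.
    by rewrite ler_wpM2l // exprS ler_piMl ?exprn_ge0 ?(ltW rho0) ?(ltW rho1).
  apply: le_trans le1; rewrite -mulrA mulrC ler_wpM2r // mulrC.
  exact: lower.
- exact: cvg_cst.
- apply: cvg_within_filter; apply: cvg_EFin; first by near=> n.
  apply: cvg_geometric; by rewrite ger0_norm; case/andP: q01.
Unshelve. all: by end_near. Qed.
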